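(* Let $(X,\mathrm d,\mathfrak m)$ be a metric measure space satisfying the $\mathrm{CD}(0,\infty)$ condition, with volume entropy $h=h_{(X,\mathrm d,\mathfrak m)}$. Then for every measurable set $\Omega\subset X$ with $\mathfrak m(\Omega)<\infty$, $$\mathfrak m^+(\Omega)\ \ge\ h\,\mathfrak m(\Omega).$$ In other words, the Cheeger constant $\mu_{(X,\mathrm d,\mathfrak m)}:=\inf_{\Omega}\frac{\mathfrak m^+(\Omega)}{\mathfrak m(\Omega)}$ satisfies $\mu_{(X,\mathrm d,\mathfrak m)}\ge h$. Moreover, the constant $h$ cannot be improved: for every $\mathrm{CD}(0,\infty)$ metric measure space $(X,\mathrm d,\mathfrak m)$ and every $C>h_{(X,\mathrm d,\mathfrak m)}$, the inequality $\mathfrak m^+(\Omega)\ge C\,\mathfrak m(\Omega)$ fails for some measurable $\Omega\subset X$ with $0<\mathfrak m(\Omega)<\infty$.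
   Context: A metric measure space $(X,\mathrm d,\mathfrak m)$ is a complete separable metric space $(X,\mathrm d)$ with a locally finite, non-negative Radon measure $\mathfrak m$ of full support. Minkowski content: for a Borel set $\Omega\subset X$ with $\mathfrak m(\Omega)<\infty$, $\mathfrak m^+(\Omega):=\liminf_{\epsilon\to0^+}\frac{\mathfrak m(\Omega^\epsilon)-\mathfrak m(\Omega)}{\epsilon}$, where $\Omega^\epsilon:=\{x:\mathrm d(x,\Omega)<\epsilon\}$. $\mathrm{CD}(0,\infty)$ condition (Lott–Sturm–Villani): let $\mathrm{Ent}_{\mathfrak m}(\mu)=\int\ln\rho\,\mathrm d\mu$ if $\mu=\rho\,\mathfrak m$ and $+\infty$ otherwise. The space satisfies $\mathrm{CD}(0,\infty)$ if for any $\mu_0,\mu_1$ in the $L^2$-Wasserstein space $(\mathcal P_2(X),W_2)$ there is a $W_2$-geodesic $(\mu_t)_{t\in[0,1]}$ from $\mu_0$ to $\mu_1$ with $\mathrm{Ent}_{\mathfrak m}(\mu_t)\le t\,\mathrm{Ent}_{\mathfrak m}(\mu_1)+(1-t)\,\mathrm{Ent}_{\mathfrak m}(\mu_0)$ for all $t\in[0,1]$. Volume entropy: $h_{(X,\mathrm d,\mathfrak m)}:=\lim_{r\to+\infty}\frac{\ln\mathfrak m(B_r(x_0))}{r}\in[0,\infty]$ for a point $x_0\in X$, where $B_r(x_0)=\{x:\mathrm d(x,x_0)<r\}$; this limit exists on every $\mathrm{CD}(0,\infty)$ space. In the Cheeger constant, the infimum is over measurable $\Omega\subset X$ with $0<\mathfrak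 m(\Omega)<\infty$. *)

(* Defs.v *)
From HB Require Import structures.
From mathcomp Require Import all_boot all_order all_algebra.
From mathcomp Require Import all_classical all_reals all_analysis.

Set Implicit Arguments.
Unset Strict Implicit.
Unset Printing Implicit Defensive.

Import Order.TTheory GRing.Theory Num.Theory.
Import numFieldNormedType.Exports.

Local Open Scope classical_set_scope.
Local Open Scope ring_scope.
Local Open Scope ereal_scope.

HB.mixin Record isBorel (d : measure_display) T
    & Topological T & Measurable d T := {
  borelE : (measurable : set (set T)) = <<s (open : set (set T)) >>
}.

(* [Complete] and [Measurable] both include a distinguished point, so the
   space is nonempty. *)
#[short(type="borelCompleteMetricType")]
HB.structure Definition BorelCompleteMetric (R : realType)
    (d : measure_display) :=
  { T of Metric R T & Complete T & Measurable d T & isBorel d T }.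

Section metric_measure_space.
Context {R : realType} {d : measure_display} {X : borelCompleteMetricType R d}.
Implicit Types (m : {measure set X -> \bar R}) (mu nu : probability X R).
Implicit Types (Omega : set X).

Definition separable_space := exists2 D : set X, countable D & dense D.

Definition locally_finite m :=
  forall x : X, exists2 U : set X, open_nbhs x U & m U < +oo.

Definition compact_inner_regular m := forall A : set X, measurable A ->
  m A = ereal_sup [set m K | K in [set K : set X | compact K /\ K `<=` A]].

Definition full_support m :=
  forall U : set X, open U -> U !=set0 -> 0 < m U.

(* For a Borel measure, Radon means locally finite and inner regular with
   respect to compact sets. *)
Record metric_measure_space m : Prop := MetricMeasureSpace {
  mms_separable : separable_space ;
  mms_locally_finite : locally_finite m ;
  mms_inner_regular : compact_inner_regular m ;
  mms_full_support : full_support m }.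

Lemma edist_mdist (x y : X) : edist (x, y) = (mdist x y)%:E.
Proof.
apply/eqP; rewrite eq_le; apply/andP; split.
- apply/lee_addgt0Pr => e e0; rewrite -EFinD; apply: edist_fin => /=.
    by rewrite ltr_wpDl// mdist_ge0.
  by rewrite ballEmdist/= ltrDl.
- rewrite /edist; apply: le_ereal_inf_tmp => _ [r [r0 /= xyr] <-].
  by move: xyr; rewrite ballEmdist/= lee_fin => /ltW.
Qed.

(* [edist_inf Omega x] is d(x, Omega), with value +oo when Omega is empty. *)
Definition enlargement Omega (eps : R) : set X :=
  [set x | edist_inf Omega x < eps%:E].

Definition minkowski_content m Omega : \bar R :=
  limf_einf (fun eps : R => (m (enlargement Omega eps) - m Omega) / eps%:E)
    (0%R : R)^'+.

Definition cheeger_constant m : \bar R :=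
  ereal_inf [set minkowski_content m Omega / m Omega |
    Omega in [set Omega | measurable Omega /\ 0 < m Omega < +oo]].

Definition volume_entropy m (x0 : X) : \bar R :=
  lim (lne (m (ball x0 r)) / r%:E @[r --> +oo%R]).

Definition wasserstein_space mu :=
  exists x0 : X, \int[mu]_x (mdist x0 x ^+ 2)%:E < +oo.

(* On a separable X, the product sigma-algebra of X * X is its Borel one. *)
Definition coupling mu nu (pi : probability (X * X)%type R) :=
  forall A : set X, measurable A ->
    pi (fst @^-1` A) = mu A /\ pi (snd @^-1` A) = nu A.

Definition W2 mu nu : \bar R :=
  sqrte (ereal_inf [set \int[pi]_z (mdist z.1 z.2 ^+ 2)%:E |
    pi in [set pi | coupling mu nu pi]]).

(* Two measures are identified when they agree on measurable sets: as functions
   on [set X] they may differ elsewhere. *)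
Definition W2_geodesic mu0 mu1 (mu : R -> probability X R) :=
  [/\ forall A : set X, measurable A -> mu 0%R A = mu0 A,
      forall A : set X, measurable A -> mu 1%R A = mu1 A,
      forall t : R, (0 <= t <= 1)%R -> wasserstein_space (mu t) &
      forall s t : R, (0 <= s <= 1)%R -> (0 <= t <= 1)%R ->
        W2 (mu s) (mu t) = `|s - t|%:E * W2 mu0 mu1].

Definition density m mu (rho : X -> R) :=
  [/\ measurable_fun setT rho, forall x, (0 <= rho x)%R &
      forall A : set X, measurable A -> mu A = \int[m]_(x in A) (rho x)%:E].

(* The value is +oo as soon as the positive part of ln rho is not integrable;
   the library would return -oo if the negative part were not integrable
   either. [ln 0 = 0] is harmless, since mu [set x | rho x = 0] = 0, and the
   value does not depend on the density, which is unique m-a.e. *)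
Definition relative_entropy m mu : \bar R :=
  if pselect (exists rho, density m mu rho) is left ex then
    let f := EFin \o (@ln R \o sval (cid ex)) in
    if \int[mu]_x (f^\+ x) == +oo then +oo else \int[mu]_x (f x)
  else +oo.

(* The dual addition makes the bound +oo, i.e. void, when it has the form
   +oo - oo. *)
Definition CD_0_infty m := forall mu0 mu1,
  wasserstein_space mu0 -> wasserstein_space mu1 ->
  exists2 mu : R -> probability X R, W2_geodesic mu0 mu1 mu &
    forall t : R, (0 <= t <= 1)%R ->
      relative_entropy m (mu t) <=
        (t%:E * relative_entropy m mu1 +
         (1 - t)%:E * relative_entropy m mu0)%dE.

End metric_measure_space.

(* Main.v *)
(* The entropy inequality of CD(0,oo), applied to the normalized restrictions of m
   to A and B, gives a Brunn-Minkowski inequality: if mdist <= L on A x B, the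
   enlargement of A by any radius larger than t * L has measure at least
   m(A)^(1-t) * m(B)^t. Indeed the geodesic at time t is carried by that
   enlargement, because transport from A at time t covers only the fraction t of
   the distance; its entropy is then bounded below by Jensen's inequality.

   Comparing two balls centered at x0, phi(r) = ln m(B_r(x0)) satisfies
   (phi(r) - phi(1)) / (r + 1) <= (phi(s) - phi(1)) / (s - 2) for 2 < s <= r, so
   balls have finite measure and phi(r) / r converges to a finite h. Comparing
   Omega with B_r(x0) for t of order eps / r and letting r go to infinity gives
   m(Omega^eps) >= m(Omega) * exp (h * eps), hence the isoperimetric inequality.
   Conversely, a better constant C would force phi to grow at a rate above h. *)

Require Import Defs.
From HB Require Import structures.
From mathcomp Require Import all_boot all_order all_algebra.
From mathcomp Require Import all_classical all_reals all_analysis.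
From mathcomp Require Import measurable_realfun ring lra.

Set Implicit Arguments.
Unset Strict Implicit.
Unset Printing Implicit Defensive.

Import Order.TTheory GRing.Theory Num.Theory.
Import numFieldNormedType.Exports.

Local Open Scope classical_set_scope.
Local Open Scope ring_scope.
Local Open Scope ereal_scope.

(** * Measures given by a density *)

Section density_measure.
Context (d : measure_display) (T : measurableType d) (R : realType).
Variables (mu : {measure set T -> \bar R}) (g : T -> \bar R).

(** The two proofs are arguments so that the measure structure, which depends on them, can be
    inferred from the term itself. *)
Definition mdensity of measurable_fun setT g & (forall x, 0 <= g x) :=
  fun A : set T => \int[mu]_(x in A) g x.

Variables (mg : measurable_fun setT g) (g0 : forall x, 0 <= g x).

Let mdensity0 : mdensity mg g0 set0 = 0.
Proof. by rewrite /mdensity integral_set0. Qed.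

Let mdensity_ge0 A : 0 <= mdensity mg g0 A.
Proof. by apply: integral_ge0 => x _. Qed.

Let mdensity_sigma_additive : semi_sigma_additive (mdensity mg g0).
Proof.
move=> F mF tF mUF; rewrite /mdensity ge0_integral_bigcup//; last first.
  exact: measurable_funTS.
by apply: is_cvg_nneseries => n _ _; exact: integral_ge0.
Qed.

HB.instance Definition _ := isMeasure.Build _ _ _ (mdensity mg g0)
  mdensity0 mdensity_ge0 mdensity_sigma_additive.

Hypothesis g1 : \int[mu]_x g x = 1.

Definition pdensity of \int[mu]_x g x = 1 := mdensity mg g0.

HB.instance Definition _ := Measure.on (pdensity g1).

HB.instance Definition _ :=
  Measure_isProbability.Build _ _ _ (pdensity g1) g1.

End density_measure.

Section integral_density.
Context (d : measure_display) (T : measurableType d) (R : realType).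
Variables (mu nu : {measure set T -> \bar R}) (g : T -> \bar R).
Hypotheses (mg : measurable_fun setT g) (g0 : forall x, 0 <= g x).
Hypothesis gfin : forall x, g x \is a fin_num.
Hypothesis nuE :
  forall A : set T, measurable A -> nu A = \int[mu]_(x in A) g x.

Import HBNNSimple.

(** Monotone convergence along simple approximations reduces the claim to indicators, where it is
    [nuE]. Finiteness of [g] lets multiplication by [g] pass to the limit. *)
Lemma integral_density (f : T -> \bar R) : measurable_fun setT f ->
  (forall x, 0 <= f x) -> \int[nu]_x f x = \int[mu]_x (f x * g x).
Proof.
move=> mf f0; pose h := nnsfun_approx measurableT mf.
have -> : \int[nu]_x f x = lim (\int[nu]_x (EFin \o h n) x @[n --> \oo]).
  have fE x : f x = lim ((EFin \o h n) x @[n --> \oo]).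
    by apply/esym/cvg_lim => //; exact: cvg_nnsfun_approx.
  under eq_integral => x _ do rewrite fE.
  apply: monotone_convergence => //.
  - by move=> n; exact/measurable_EFinP/measurable_funP.
  - by move=> n x _ /=; rewrite lee_fin.
  - by move=> x _ a b ab; rewrite lee_fin; exact/lefP/nd_nnsfun_approx.
have -> : \int[mu]_x (f x * g x) =
    lim (\int[mu]_x ((EFin \o h n) \* g) x @[n --> \oo]).
  have fg x : f x * g x = lim (((EFin \o h n) \* g) x @[n --> \oo]).
    apply/esym/cvg_lim => //; apply: cvgeZr; first exact: gfin.
    exact: cvg_nnsfun_approx.
  under eq_integral => x _ do rewrite fg.
  apply: monotone_convergence => //.
  - move=> n; apply: emeasurable_funM => //.
    exact/measurable_EFinP/measurable_funP.
  - by move=> n x _ /=; rewrite mule_ge0 ?lee_fin.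
  - move=> x _ a b ab /=; rewrite lee_wpmul2r ?lee_fin//.
    exact/lefP/nd_nnsfun_approx.
apply: congr_lim; apply/funext => n.
have mhr r : measurable (h n @^-1` [set r]) by exact: measurable_sfunP.
transitivity (\int[nu]_x
   (\sum_(y \in range (h n)) (y * \1_(h n @^-1` [set y]) x)%:E)).
  by apply: eq_integral => t _; rewrite /= fimfunE -fsumEFin.
have mindic r : measurable_fun setT (fun x => (r * \1_(h n @^-1` [set r]) x)%:E).
  by apply/measurable_EFinP/measurable_funM => //; exact: measurable_indic.
rewrite ge0_integral_fsum//; last by move=> r x _; exact: nnfun_muleindic_ge0.
transitivity (\int[mu]_x (\sum_(y \in range (h n))
    (y * \1_(h n @^-1` [set y]) x)%:E * g x)); last first.
  apply: eq_integral => x _ /=.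
  rewrite -ge0_mule_fsuml => [|y]; last exact: nnfun_muleindic_ge0.
  by rewrite fsumEFin// -fimfunE.
rewrite ge0_integral_fsum//; last 2 first.
  - by move=> y; apply: emeasurable_funM => //; exact: mindic.
  - by move=> r x _; rewrite mule_ge0// nnfun_muleindic_ge0.
apply: eq_fsbigr => r /[!inE] -[x0 _ hx0].
have r0 : (0 <= r)%R by rewrite -hx0.
under eq_integral do rewrite EFinM.
under [RHS]eq_integral do rewrite EFinM -muleA.
rewrite !ge0_integralZl//; last 3 first.
- apply: emeasurable_funM => //; apply/measurable_EFinP.
  exact: measurable_indic.
- by move=> x _; rewrite mule_ge0// lee_fin.
- by apply/measurable_EFinP; exact: measurable_indic.
congr (_ * _); rewrite integral_indic// setIT nuE// integral_mkcond.
by apply: eq_integral => x _; rewrite epatch_indic muleC.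
Qed.

End integral_density.

(** * Balls, enlargements and small cells in a separable metric space *)

Section borel_metric.
Context {R : realType} {d : measure_display} {X : borelCompleteMetricType R d}.
Implicit Types (A : set X) (x y : X).

Lemma borel_open_measurable A : open A -> measurable A.
Proof. by move=> oA; rewrite borelE; exact: sub_sigma_algebra. Qed.

Lemma metric_ball_open x (r : R) : open (ball x r).
Proof.
rewrite openE => y; rewrite ballEmdist/= => xyr.
apply/nbhs_ballP; exists (r - mdist x y)%R => /=; first by rewrite subr_gt0.
move=> z; rewrite ballEmdist/= => yzr.
by rewrite (le_lt_trans (metric_triangle _ y _))// -ltrBrDl.
Qed.

Lemma measurable_metric_ball x (r : R) : measurable (ball x r : set X).
Proof. exact/borel_open_measurable/metric_ball_open. Qed.

Lemma enlargementP A (e : R) x :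
  enlargement A e x <-> exists2 a, A a & (mdist x a < e)%R.
Proof.
rewrite /enlargement/= /edist_inf; split.
  by move=> /ereal_inf_lt[_ [a Aa <-]]; rewrite edist_mdist lte_fin; exists a.
move=> [a Aa xae]; apply: (@le_lt_trans _ _ (edist (x, a))); last by rewrite edist_mdist lte_fin.
by apply: ereal_inf_lbound; exists a.
Qed.

Lemma enlargement_open A (e : R) : open (enlargement A e).
Proof.
rewrite (_ : enlargement A e = \bigcup_(a in A) ball a e).
  by apply: bigcup_open => a _; exact: metric_ball_open.
apply/seteqP; split => x.
  by move=> /enlargementP[a Aa ?]; exists a => //; rewrite ballEmdist/= metric_sym.
move=> [a Aa]; rewrite ballEmdist/= => ?; apply/enlargementP; exists a => //.
by rewrite metric_sym.
Qed.

Lemma measurable_enlargement A (e : R) : measurable (enlargement A e).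
Proof. exact/borel_open_measurable/enlargement_open. Qed.

Lemma subset_enlargement A (e : R) : (0 < e)%R -> A `<=` enlargement A e.
Proof.
by move=> e0 x Ax; apply/enlargementP; exists x => //; rewrite mdistxx.
Qed.

Lemma enlargementS A B (e : R) : A `<=` B -> enlargement A e `<=` enlargement B e.
Proof.
by move=> AB x /enlargementP[a /AB Ba xa]; apply/enlargementP; exists a.
Qed.

Lemma enlargement_ball x (r e : R) :
  enlargement (ball x r) e `<=` ball x (r + e).
Proof.
move=> z /enlargementP[a]; rewrite !ballEmdist/= => xa za.
by rewrite (le_lt_trans (metric_triangle _ a _))// ltrD// metric_sym.
Qed.

Lemma measurable_funr_lt (d' : measure_display) (T : measurableType d')
    (f : T -> R) :
  (forall r, measurable [set x | (f x < r)%R]) -> measurable_fun setT f.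
Proof.
move=> mf; apply: (measurability _ (RGenInftyO.measurableE R)) => //.
move=> _ [_ [r ->] <-]; rewrite setTI (_ : _ @^-1` _ = [set x | (f x < r)%R])//.
Qed.

Lemma measurable_mdist x : measurable_fun setT (mdist x).
Proof.
apply: measurable_funr_lt => r; rewrite (_ : [set _ | _] = ball x r).
  exact: measurable_metric_ball.
by rewrite ballEmdist.
Qed.

Hypothesis sX : @separable_space R d X.

Lemma dense_sequence :
  exists q : nat -> X, forall x (e : R), (0 < e)%R -> exists n, (mdist (q n) x < e)%R.
Proof.
have [D cD dD] := sX.
have [q qD] := pcard_surjP cD.
exists q => x e e0.
have : ball x e `&` D !=set0.
  apply: dD; last exact: metric_ball_open.
  by exists x; rewrite ballEmdist/= mdistxx.
move=> [y [+ /qD[n _ qny]]]; rewrite ballEmdist/= => xy.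
by exists n; rewrite qny metric_sym.
Qed.

(** Separability makes each sublevel set a countable union of sets
    [mdist (q n) z.1 + mdist (q n) z.2 < r], whose left sides are sums of measurable functions of
    one coordinate. *)
Lemma measurable_mdist2 : measurable_fun setT (fun z : X * X => mdist z.1 z.2).
Proof.
have [q qP] := dense_sequence.
apply: measurable_funr_lt => r.
rewrite (_ : [set _ | _] =
    \bigcup_n [set z : X * X | (mdist (q n) z.1 + mdist (q n) z.2 < r)%R]).
  apply: bigcup_measurable => n _.
  have mq : measurable_fun setT (fun z : X * X => mdist (q n) z.1 + mdist (q n) z.2)%R.
    apply: measurable_funD.
      exact: measurableT_comp (measurable_mdist _) measurable_fst.
    exact: measurableT_comp (measurable_mdist _) measurable_snd.
  rewrite -[X in measurable X]setTI.
  have /= := mq measurableT `]-oo, r[%classic (measurable_itv _).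
  by congr measurable; apply/seteqP; split => z /=; rewrite in_itv.
apply/seteqP; split => [[x y] /= xyr|[x y] [n _ /=] nr].
  (* Half of the slack suffices: the detour through [q n] exceeds [mdist x y] by at most
     [2 * mdist (q n) x]. *)
  have [n nx] : exists n, (mdist (q n) x < (r - mdist x y) / 2)%R.
    by apply: qP; rewrite divr_gt0// subr_gt0.
  exists n => //=; have := metric_triangle (q n) x y; lra.
by rewrite (le_lt_trans (metric_triangle _ (q n) _))// metric_sym.
Qed.

(** Balls of radius [e / 2] around a dense sequence cover the space; making them disjoint only
    shrinks them. *)
Lemma small_cells (e : R) : (0 < e)%R -> exists E : nat -> set X,
  [/\ forall i, measurable (E i), trivIset setT E, \bigcup_i E i = setT &
      forall i x y, E i x -> E i y -> (mdist x y < e)%R].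
Proof.
move=> e0; have [q qP] := dense_sequence.
pose B n : set X := ball (q n) (e / 2)%R.
exists (seqDU B); split.
- move=> i; apply: measurableD; first exact: measurable_metric_ball.
  by apply: bigsetU_measurable => j _; exact: measurable_metric_ball.
- exact: trivIset_seqDU.
- rewrite -seqDU_bigcup_eq; apply/seteqP; split => // x _.
  have [n nx] : exists n, (mdist (q n) x < e / 2)%R by apply: qP; rewrite divr_gt0.
  by exists n => //; rewrite /B ballEmdist.
- move=> i x y Ex Ey; have := @subset_seqDU _ B i x Ex.
  have := @subset_seqDU _ B i y Ey; rewrite /B ballEmdist/= => qy qx.
  have := metric_triangle x (q i) y; rewrite (metric_sym x (q i)); lra.
Qed.

End borel_metric.

(** * Approximate gluing of two couplings along a common marginal *)

(* A substitute for the gluing lemma that avoids disintegration: the two middle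
   points are not matched exactly, only up to the cells of a countable partition. *)
Section cellwise_gluing.
Context (d : measure_display) (T : measurableType d) (R : realType).
Variables (E : nat -> set T) (mE : forall i, measurable (E i)).
Hypotheses (tE : trivIset setT E) (cE : \bigcup_i E i = setT).
Variables (nu : probability T R) (pi1 pi2 : probability (T * T)%type R).
Hypothesis pi1nu : forall A, measurable A -> pi1 (snd @^-1` A) = nu A.
Hypothesis pi2nu : forall A, measurable A -> pi2 (fst @^-1` A) = nu A.

Let W := ((T * T) * (T * T))%type.

(** For [w = ((x, z), (z', y))] the value is [1 / nu (E k)] if [z] and [z'] share the cell [E k],
    and 0 otherwise: given the common cell, the two couplings are independent. On a null cell the
    inverse defaults to 0, which is harmless because such cells carry no mass. *)
Definition glue_density (w : W) : \bar R :=
  \sum_(i <oo) (\1_(E i) w.1.2 * \1_(E i) w.2.1 / fine (nu (E i)))%:E.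

Let term_ge0 i (w : W) :
  0 <= (\1_(E i) w.1.2 * \1_(E i) w.2.1 / fine (nu (E i)) : R)%:E.
Proof. by rewrite lee_fin !mulr_ge0// invr_ge0 fine_ge0. Qed.

Lemma glue_density_ge0 w : 0 <= glue_density w.
Proof. by apply: nneseries_ge0 => i _ _. Qed.

Let mfst (A : set T) : measurable A -> measurable (fst @^-1` A : set (T * T)).
Proof. by move=> mA; rewrite -[X in measurable X]setTI; exact: measurable_fst. Qed.

Let msnd (A : set T) : measurable A -> measurable (snd @^-1` A : set (T * T)).
Proof. by move=> mA; rewrite -[X in measurable X]setTI; exact: measurable_snd. Qed.

Lemma measurable_glue_density : measurable_fun setT glue_density.
Proof.
apply: ge0_emeasurable_sum => // k _; apply/measurable_EFinP.
have mi : measurable_fun setT (\1_(E k) : T -> R) by exact: measurable_indic.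
apply: measurable_funM => //; apply: measurable_funM.
  apply: (measurableT_comp mi).
  exact: (measurableT_comp measurable_snd measurable_fst).
apply: (measurableT_comp mi).
exact: (measurableT_comp measurable_fst measurable_snd).
Qed.

Let cell (x : T) : exists k, E k x.
Proof. by have : setT x by []; rewrite -cE => -[k _ Ek]; exists k. Qed.

Let cell_uniq i j x : E i x -> E j x -> i = j.
Proof. by move=> Ei Ej; apply: (tE I I); exists x. Qed.

Lemma glue_densityl w k : E k w.1.2 ->
  glue_density w = (\1_(E k) w.2.1 / fine (nu (E k)))%:E.
Proof.
move=> Ek; rewrite /glue_density (@nneseriesD1 _ _ k)// eseries0 ?adde0.
  by rewrite indicE mem_set// mul1r.
move=> i _ /= ik; rewrite (indicE _ _ w.1.2) memNset ?mul0r// => Ei.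
by move/negP : ik; apply; rewrite (cell_uniq Ei Ek).
Qed.

Lemma glue_densityr w k : E k w.2.1 ->
  glue_density w = (\1_(E k) w.1.2 / fine (nu (E k)))%:E.
Proof.
move=> Ek; rewrite /glue_density (@nneseriesD1 _ _ k)// eseries0 ?adde0.
  by rewrite (indicE _ _ w.2.1) mem_set// mulr1.
move=> i _ /= ik; rewrite (indicE _ _ w.2.1) memNset ?mulr0 ?mul0r// => Ei.
by move/negP : ik; apply; rewrite (cell_uniq Ei Ek).
Qed.

Lemma glue_density_fin_num w : glue_density w \is a fin_num.
Proof. by have [k /glue_densityl ->] := cell w.1.2. Qed.

Lemma glue_density_eq0 w : (forall k, ~ (E k w.1.2 /\ E k w.2.1)) ->
  glue_density w = 0.
Proof.
move=> kN; have [k Ek] := cell w.1.2; rewrite (glue_densityl Ek) indicE memNset ?mul0r//.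
by move=> Ek'; apply: (kN k).
Qed.

Let null_cells : nu.-negligible (\bigcup_(k in [set k | nu (E k) = 0]) E k).
Proof.
rewrite bigcup_mkcond; apply: negligible_bigcup => k.
case: ifPn => [/[!inE] nuk|_]; last exact: negligible_set0.
by exists (E k); split.
Qed.

Lemma glue_integral_fst (f : T * T -> \bar R) : measurable_fun setT f ->
  (forall x, 0 <= f x) ->
  \int[pi1 \x pi2]_w (f w.1 * glue_density w) = \int[pi1]_x f x.
Proof.
move=> mf f0; pose F (w : W) := f w.1 * glue_density w.
have mF : measurable_fun setT F.
  apply: emeasurable_funM; last exact: measurable_glue_density.
  exact: measurableT_comp.
have F0 w : 0 <= F w by rewrite mule_ge0// glue_density_ge0.
rewrite (fubini_tonelli1 F)//; apply: ae_eq_integral => //.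
  exact: (measurable_fun_fubini_tonelli_F F).
have [N [mN nuN cN]] := null_cells.
exists (snd @^-1` N); split; [exact: msnd|by rewrite /= pi1nu|].
move=> x /=; apply: contra_notP => Nx _; have [k Ek] := cell x.2.
have k0 : fine (nu (E k)) != 0%R.
  apply/eqP => k0; apply: Nx; apply: cN; exists k => //=.
  by rewrite -[LHS]fineK ?fin_num_measure// k0.
rewrite /fubini_F /F /=.
under eq_integral => y _ do rewrite (@glue_densityl (x, y) k Ek) /= EFinM.
have m1 : measurable_fun setT (fun y : T * T => (\1_(E k) y.1)%:E : \bar R).
  have mi : measurable_fun setT (\1_(E k) : T -> R) by exact: measurable_indic.
  by apply/measurable_EFinP; exact: (measurableT_comp mi measurable_fst).
rewrite ge0_integralZl//; last 2 first.
  by apply: emeasurable_funM.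
  by move=> y _; rewrite -EFinM lee_fin mulr_ge0// invr_ge0 fine_ge0.
rewrite ge0_integralZr//; last 1 first.
  by rewrite lee_fin invr_ge0 fine_ge0.
rewrite (_ : \int[_]_ _ _ = nu (E k)).
  by rewrite -{1}(fineK (fin_num_measure nu _ (mE k))) -EFinM divff// mule1.
by rewrite -pi2nu// -[X in _ = pi2 X]setIT -integral_indic//; exact: mfst.
Qed.

Lemma glue_integral_snd (f : T * T -> \bar R) : measurable_fun setT f ->
  (forall x, 0 <= f x) ->
  \int[pi1 \x pi2]_w (f w.2 * glue_density w) = \int[pi2]_x f x.
Proof.
move=> mf f0; pose F (w : W) := f w.2 * glue_density w.
have mF : measurable_fun setT F.
  apply: emeasurable_funM; last exact: measurable_glue_density.
  exact: measurableT_comp.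
have F0 w : 0 <= F w by rewrite mule_ge0// glue_density_ge0.
rewrite (fubini_tonelli2 F)//; apply: ae_eq_integral => //.
  exact: (measurable_fun_fubini_tonelli_G F).
have [N [mN nuN cN]] := null_cells.
exists (fst @^-1` N); split; [exact: mfst|by rewrite /= pi2nu|].
move=> x /=; apply: contra_notP => Nx _; have [k Ek] := cell x.1.
have k0 : fine (nu (E k)) != 0%R.
  apply/eqP => k0; apply: Nx; apply: cN; exists k => //=.
  by rewrite -[LHS]fineK ?fin_num_measure// k0.
rewrite /fubini_G /F /=.
under eq_integral => y _ do rewrite (@glue_densityr (y, x) k Ek) /= EFinM.
have m1 : measurable_fun setT (fun y : T * T => (\1_(E k) y.2)%:E : \bar R).
  have mi : measurable_fun setT (\1_(E k) : T -> R) by exact: measurable_indic.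
  by apply/measurable_EFinP; exact: (measurableT_comp mi measurable_snd).
rewrite ge0_integralZl//; last 2 first.
  by apply: emeasurable_funM.
  by move=> y _; rewrite -EFinM lee_fin mulr_ge0// invr_ge0 fine_ge0.
rewrite ge0_integralZr//; last 1 first.
  by rewrite lee_fin invr_ge0 fine_ge0.
rewrite (_ : \int[_]_ _ _ = nu (E k)).
  by rewrite -{1}(fineK (fin_num_measure nu _ (mE k))) -EFinM divff// mule1.
by rewrite -pi1nu// -[X in _ = pi1 X]setIT -integral_indic//; exact: msnd.
Qed.

Lemma glue_density_integral1 : \int[pi1 \x pi2]_w glue_density w = 1.
Proof.
under eq_integral do rewrite -[glue_density _]mul1e.
rewrite (@glue_integral_fst (cst 1))//.
by rewrite integral_cst// mul1e; exact: probability_setT.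
Qed.

Let endpoints (w : W) : T * T := (w.1.1, w.2.2).

Let measurable_endpoints : measurable_fun setT endpoints.
Proof.
apply/measurable_fun_pairP; split.
  exact: (measurableT_comp measurable_fst measurable_fst).
exact: (measurableT_comp measurable_snd measurable_snd).
Qed.

(** The coupling is the law of the outer endpoints under the glued measure. The integral formula
    belongs to the conclusion because costs are later compared on the space of quadruples. *)
Lemma exists_glue : exists pi : probability (T * T)%type R,
  [/\ forall A, measurable A -> pi (fst @^-1` A) = pi1 (fst @^-1` A),
      forall A, measurable A -> pi (snd @^-1` A) = pi2 (snd @^-1` A) &
      forall f : T * T -> \bar R, measurable_fun setT f -> (forall x, 0 <= f x) ->
        \int[pi]_x f x =
        \int[pi1 \x pi2]_w (f (w.1.1, w.2.2) * glue_density w)].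
Proof.
pose P : probability W R := pdensity measurable_glue_density
  glue_density_ge0 glue_density_integral1.
pose phi : {mfun W >-> (T * T)%type} :=
  HB.pack endpoints (isMeasurableFun.Build _ _ _ _ _ measurable_endpoints).
pose Q : probability (T * T)%type R := distribution P phi.
have QE f : measurable_fun setT f -> (forall x, 0 <= f x) ->
    \int[Q]_x f x = \int[pi1 \x pi2]_w (f (w.1.1, w.2.2) * glue_density w).
  move=> mf f0; rewrite ge0_integral_distribution//.
  rewrite (@integral_density _ _ _ (pi1 \x pi2) P glue_density)//.
  - exact: measurable_glue_density.
  - exact: glue_density_ge0.
  - exact: glue_density_fin_num.
  - exact: measurableT_comp.
  - by move=> w; exact: f0.
have ind (A : set (T * T)) : measurable A ->
    measurable_fun setT (fun x => (\1_A x)%:E : \bar R).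
  by move=> mA; apply/measurable_EFinP; exact: measurable_indic.
exists Q; split => // A mA.
- have mA' := mfst mA.
  rewrite -[fst @^-1` A]setIT -[in LHS]integral_indic// -integral_indic//.
  rewrite QE//; last exact: ind.
  by rewrite -(glue_integral_fst (ind _ mA')).
- have mA' := msnd mA.
  rewrite -[snd @^-1` A]setIT -[in LHS]integral_indic// -integral_indic//.
  rewrite QE//; last exact: ind.
  by rewrite -(glue_integral_snd (ind _ mA')).
Qed.

(** A pointwise inequality between costs becomes one between integrals: all four integrals are
    written against the glued measure, whose density vanishes unless both middle points share a
    cell. Hence the inequality is only required there. *)
Lemma glue_le (F1 F2 G H : T * T -> \bar R) :
  measurable_fun setT F1 -> measurable_fun setT F2 ->
  measurable_fun setT G -> measurable_fun setT H ->
  (forall x, 0 <= F1 x) -> (forall x, 0 <= F2 x) ->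
  (forall x, 0 <= G x) -> (forall x, 0 <= H x) ->
  (forall k x z z' y, E k z -> E k z' ->
    G (x, y) + H (x, z) <= F1 (x, z) + F2 (z', y)) ->
  exists pi : probability (T * T)%type R,
  [/\ forall A, measurable A -> pi (fst @^-1` A) = pi1 (fst @^-1` A),
      forall A, measurable A -> pi (snd @^-1` A) = pi2 (snd @^-1` A) &
      \int[pi]_x G x + \int[pi1]_x H x <= \int[pi1]_x F1 x + \int[pi2]_x F2 x].
Proof.
move=> mF1 mF2 mG mH F10 F20 G0 H0 GHF.
have [Q [Q1 Q2 QE]] := exists_glue; exists Q; split => //.
have mg := measurable_glue_density; have g0 := glue_density_ge0.
have mf1 (f : T * T -> \bar R) : measurable_fun setT f ->
    measurable_fun setT (fun w : W => f w.1 * glue_density w).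
  by move=> mf; apply: emeasurable_funM => //; exact: measurableT_comp.
have mf2 (f : T * T -> \bar R) : measurable_fun setT f ->
    measurable_fun setT (fun w : W => f w.2 * glue_density w).
  by move=> mf; apply: emeasurable_funM => //; exact: measurableT_comp.
have mfe (f : T * T -> \bar R) : measurable_fun setT f ->
    measurable_fun setT (fun w : W => f (w.1.1, w.2.2) * glue_density w).
  move=> mf; apply: emeasurable_funM => //.
  exact: (measurableT_comp mf measurable_endpoints).
rewrite QE// -(glue_integral_fst mH)// -(glue_integral_fst mF1)//.
rewrite -(glue_integral_snd mF2)// -!ge0_integralD//;
  try (by move=> w _; rewrite mule_ge0) ; try exact: mf1; try exact: mf2;
  try exact: mfe.
apply: ge0_le_integral => //.
- by move=> w _; rewrite adde_ge0// mule_ge0.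
- by apply: emeasurable_funD; [exact: mfe|exact: mf1].
- by apply: emeasurable_funD; [exact: mf1|exact: mf2].
move=> w _; rewrite -!ge0_muleDl//.
have [[k [Ek1 Ek2]]|kN] := pselect (exists k, E k w.1.2 /\ E k w.2.1).
  apply: lee_wpmul2r => //.
  by move: w Ek1 Ek2 => [[x z] [z' y]]/=; exact: GHF.
rewrite glue_density_eq0 ?mule0// => k Ek.
by apply: kN; exists k.
Qed.

End cellwise_gluing.

(** * Transport costs and localization at intermediate times *)

Section intermediate_cost.
Local Open Scope ring_scope.

(** Here [a], [b], [D] stand for the lengths of the two legs and of the whole transport, and [e] for
    the mismatch at the middle. Expanding the squares around [a = t * D] and [b = (1 - t) * D]
    leaves the deficit [(a - t * D) ^+ 2 / t]; the mismatch costs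
    [2 * e * D <= e * (D ^+ 2 + 1)]. *)
Lemma intermediate_cost (R : realFieldType) (t e a b D : R) :
  0 < t < 1 -> 0 <= e -> 0 <= D -> D <= a + b + e ->
  (1 - e) * D ^+ 2 + (a - t * D) ^+ 2 / t <=
  a ^+ 2 / t + b ^+ 2 / (1 - t) + e.
Proof.
move=> /andP[t0 t1] e0 D0 Dab; have t1' : 0 < 1 - t by rewrite subr_gt0.
have aE : a ^+ 2 / t = t * D ^+ 2 + 2 * D * (a - t * D) + (a - t * D) ^+ 2 / t.
  by field; rewrite gt_eqF.
have bE : b ^+ 2 / (1 - t) =
    2 * D * b - (1 - t) * D ^+ 2 + (b - (1 - t) * D) ^+ 2 / (1 - t).
  by field; rewrite gt_eqF.
have b0 : 0 <= (b - (1 - t) * D) ^+ 2 / (1 - t).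
  by rewrite divr_ge0 ?sqr_ge0// ltW.
have De : 0 <= e * (D - 1) ^+ 2 by rewrite mulr_ge0 ?sqr_ge0.
have : 0 <= D * (a + b + e - D) by rewrite mulr_ge0 ?subr_ge0.
rewrite aE bE; nra.
Qed.

End intermediate_cost.

Section transport.
Context {R : realType} {d : measure_display} {X : borelCompleteMetricType R d}.
Implicit Types (A B : set X) (mu nu : probability X R).

Definition transport_cost (P : probability (X * X)%type R) : \bar R :=
  \int[P]_z (mdist z.1 z.2 ^+ 2)%:E.

(** Gluing almost optimal couplings of the two legs gives a coupling of [mu0] and [mu1], of cost at
    least [w]. This leaves almost no room for the deficit of [intermediate_cost], while every middle
    point outside the enlargement, with endpoints in [A] and [B], contributes a deficit bounded
    below. *)
Lemma intermediate_concentration mu0 nu mu1 (t w L gam : R) A B :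
  @separable_space R d X -> (0 < t < 1)%R -> (0 <= w)%R -> (0 < gam)%R ->
  (forall P, coupling mu0 mu1 P -> w%:E <= transport_cost P) ->
  (forall e : R, (0 < e)%R -> exists2 P, coupling mu0 nu P &
    transport_cost P <= (t ^+ 2 * w + e)%:E) ->
  (forall e : R, (0 < e)%R -> exists2 P, coupling nu mu1 P &
    transport_cost P <= ((1 - t) ^+ 2 * w + e)%:E) ->
  measurable A -> measurable B -> mu0 (~` A) = 0 -> mu1 (~` B) = 0 ->
  (forall x y, A x -> B y -> (mdist x y <= L)%R) ->
  nu (~` enlargement A (t * L + gam)) = 0.
Proof.
move=> sX t01 w0 gam0 cost01 cost0 cost1 mA mB muA muB dAB.
have /andP[t0 t1] := t01.
set N := ~` _; have mN : measurable N.
  by apply: measurableC; exact: measurable_enlargement.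
(* Outside the enlargement [a >= t * L + gam >= t * D + gam], so the deficit [(a - t * D) ^+ 2 / t]
   is at least [kap]. *)
pose kap : R := (gam ^+ 2 / t)%R.
have kap0 : (0 < kap)%R by rewrite divr_gt0// exprn_gt0.
(* [K] collects the errors of order [e]: [e] itself from the cell mismatch, [e * w] from the factor
   [1 - e], and [e / t], [e / (1 - t)] from the two nonoptimal couplings. *)
pose K : R := (1 + w + t^-1 + (1 - t)^-1)%R.
suff main (e : R) : (0 < e < 1)%R -> (kap * fine (nu N) <= e * K)%R.
  have nuN : nu N \is a fin_num by exact: fin_num_measure.
  rewrite -(fineK nuN); congr EFin; apply/eqP; rewrite eq_le fine_ge0// andbT.
  have K0 : (0 < K)%R.
    have : (0 < t^-1)%R by rewrite invr_gt0.
    have : (0 < (1 - t)^-1)%R by rewrite invr_gt0 subr_gt0.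
    rewrite /K; lra.
  rewrite leNgt; apply/negP => nuN0.
  have c0 : (0 < kap * fine (nu N))%R by rewrite mulr_gt0.
  (* With this choice [e * K] is at most half of [kap * fine (nu N)], which contradicts [main]. *)
  pose e := Num.min (2^-1)%R (kap * fine (nu N) / (2 * K))%R.
  have e0 : (0 < e)%R by rewrite lt_min invr_gt0 ltr0n/= divr_gt0// mulr_gt0.
  have e1 : (e < 1)%R by rewrite gt_min invf_lt1 ?ltr1n.
  have := main e; rewrite e0 e1 => /(_ isT).
  have : (e <= kap * fine (nu N) / (2 * K))%R by rewrite ge_min lexx orbT.
  rewrite ler_pdivlMr ?mulr_gt0//; lra.
move=> /andP[e0 e1].
have [P1 cP1 P1cost] := cost0 _ e0; have [P2 cP2 P2cost] := cost1 _ e0.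
have [E [mE tE cE dE]] := small_cells sX e0.
have P1nu S : measurable S -> P1 (snd @^-1` S) = nu S by move=> /cP1[].
have P2nu S : measurable S -> P2 (fst @^-1` S) = nu S by move=> /cP2[].
have md : measurable_fun setT (fun z : X * X => (mdist z.1 z.2 ^+ 2)%R).
  exact: measurable_funX (measurable_mdist2 sX).
have mi1 (S : set X) : measurable S ->
    measurable_fun setT (fun z : X * X => \1_S z.1 : R).
  move=> mS; have mi : measurable_fun setT (\1_S : X -> R).
    exact: measurable_indic.
  exact: (measurableT_comp mi measurable_fst).
have mi2 (S : set X) : measurable S ->
    measurable_fun setT (fun z : X * X => \1_S z.2 : R).
  move=> mS; have mi : measurable_fun setT (\1_S : X -> R).
    exact: measurable_indic.
  exact: (measurableT_comp mi measurable_snd).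
have mAC := measurableC mA; have mBC := measurableC mB.
(* The penalties [kap] off [A] and off [B] make the pointwise inequality hold for all endpoints, and
   they integrate to 0 since [mu0] and [mu1] are carried by [A] and [B]. *)
pose F1 (z : X * X) := (t^-1 * mdist z.1 z.2 ^+ 2 + (e + kap * \1_(~` A) z.1))%:E.
pose F2 (z : X * X) := ((1 - t)^-1 * mdist z.1 z.2 ^+ 2 + kap * \1_(~` B) z.2)%:E.
pose G (z : X * X) := ((1 - e) * mdist z.1 z.2 ^+ 2)%:E.
pose H (z : X * X) := (kap * \1_N z.2)%:E.
have t1' : (0 < 1 - t)%R by rewrite subr_gt0.
have e1' : (0 < 1 - e)%R by rewrite subr_gt0.
have ti0 : (0 <= t^-1)%R by rewrite invr_ge0 ltW.
have ti1 : (0 <= (1 - t)^-1)%R by rewrite invr_ge0 ltW.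
have mF1 : measurable_fun setT F1.
  apply/measurable_EFinP; apply: measurable_funD; first exact: measurable_funM.
  apply: measurable_funD => //; apply: measurable_funM => //; exact: mi1.
have mF2 : measurable_fun setT F2.
  apply/measurable_EFinP; apply: measurable_funD; first exact: measurable_funM.
  apply: measurable_funM => //; exact: mi2.
have mG : measurable_fun setT G by apply/measurable_EFinP; exact: measurable_funM.
have mH : measurable_fun setT H.
  apply/measurable_EFinP; apply: measurable_funM => //; exact: mi2.
have gam0' := ltW gam0; have e0' := ltW e0; have kap0' := ltW kap0; have e1'' := ltW e1'.
have F10 x : 0 <= F1 x by rewrite /F1 lee_fin !addr_ge0 ?mulr_ge0 ?mdist_ge0.
have F20 x : 0 <= F2 x by rewrite /F2 lee_fin !addr_ge0 ?mulr_ge0 ?mdist_ge0.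
have G0 x : 0 <= G x by rewrite /G lee_fin !mulr_ge0 ?mdist_ge0.
have H0 x : 0 <= H x by rewrite /H lee_fin mulr_ge0.
have pointwise k x z z' y : E k z -> E k z' ->
    G (x, y) + H (x, z) <= F1 (x, z) + F2 (z', y).
  move=> Ez Ez'; rewrite /G /H /F1 /F2 -!EFinD lee_fin/=.
  have zz' := dE _ _ _ Ez Ez'.
  set a := mdist x z; set b := mdist z' y; set D := mdist x y.
  have D0 : (0 <= D)%R by exact: mdist_ge0.
  have Dab : (D <= a + b + e)%R.
    have := metric_triangle x z y; have := metric_triangle z z' y.
    rewrite -/a -/b -/D; lra.
  have := intermediate_cost t01 (ltW e0) D0 Dab.
  suff : (kap * \1_N z <= (a - t * D) ^+ 2 / t +
      kap * \1_(~` A) x + kap * \1_(~` B) y)%R by lra.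
  have sq0 : (0 <= (a - t * D) ^+ 2 / t)%R by rewrite divr_ge0 ?sqr_ge0// ltW.
  have [Ax|nAx] := pselect (A x); last first.
    rewrite (indicE _ (~` A)) mem_set// mulr1.
    have : (kap * \1_N z <= kap)%R by rewrite ler_piMr ?(ltW kap0)// indicE lern1 leq_b1.
    have : (0 <= kap * \1_(~` B) y)%R by rewrite mulr_ge0.
    lra.
  have [By|nBy] := pselect (B y); last first.
    rewrite (indicE _ (~` B)) mem_set// mulr1.
    have : (kap * \1_N z <= kap)%R by rewrite ler_piMr ?(ltW kap0)// indicE lern1 leq_b1.
    have : (0 <= kap * \1_(~` A) x)%R by rewrite mulr_ge0.
    lra.
  rewrite (indicE _ (~` A)) (indicE _ (~` B)) !memNset ?mulr0 ?addr0//.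
  have [Nz|nNz] := pselect (N z); last by rewrite indicE memNset ?mulr0.
  rewrite indicE mem_set// mulr1 /kap ler_pM2r ?invr_gt0//.
  have ga : (t * L + gam <= a)%R.
    rewrite leNgt; apply/negP => ax; apply: Nz; apply/enlargementP.
    by exists x => //; rewrite metric_sym.
  have DL : (t * D <= t * L)%R by rewrite ler_pM2l//; exact: dAB.
  by rewrite ler_sqr ?nnegrE; lra.
have [P [P1E P2E]] := glue_le mE tE cE P1nu P2nu mF1 mF2 mG mH F10 F20 G0 H0 pointwise.
have cP : coupling mu0 mu1 P.
  move=> S mS; rewrite P1E// P2E//.
  by have [-> _] := cP1 _ mS; have [_ ->] := cP2 _ mS.
have mdE : measurable_fun setT (fun z : X * X => (mdist z.1 z.2 ^+ 2)%:E).
  exact/measurable_EFinP.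
have d0 (z : X * X) : 0 <= (mdist z.1 z.2 ^+ 2)%:E by rewrite lee_fin sqr_ge0.
have intI (Q : probability (X * X)%type R) (S : set (X * X)) : measurable S ->
    \int[Q]_z (kap * \1_S z)%:E = kap%:E * Q S.
  move=> mS; under eq_integral do rewrite EFinM.
  rewrite ge0_integralZl ?lee_fin ?(ltW kap0)//; last first.
    by apply/measurable_EFinP; exact: measurable_indic.
  by rewrite integral_indic// setIT.
have mS1 (S : set X) : measurable S -> measurable (fst @^-1` S : set (X * X)).
  by move=> mS; rewrite -[X in measurable X]setTI; exact: measurable_fst.
have mS2 (S : set X) : measurable S -> measurable (snd @^-1` S : set (X * X)).
  by move=> mS; rewrite -[X in measurable X]setTI; exact: measurable_snd.
have -> : \int[P]_x G x = (1 - e)%:E * transport_cost P.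
  rewrite /G; under eq_integral do rewrite EFinM.
  by rewrite ge0_integralZl// lee_fin ltW.
have -> : \int[P1]_x H x = kap%:E * nu N.
  by rewrite -P1nu// -(intI _ _ (mS2 _ mN)).
have -> : \int[P1]_x F1 x = (t^-1)%:E * transport_cost P1 + e%:E.
  rewrite /F1; under eq_integral do rewrite EFinD EFinM.
  rewrite ge0_integralD//; last 4 first.
  - by move=> z _; rewrite mule_ge0.
  - exact: emeasurable_funM.
  - by move=> z _; rewrite lee_fin addr_ge0 ?mulr_ge0.
  - apply/measurable_EFinP; apply: measurable_funD => //; apply: measurable_funM => //.
    exact: mi1.
  rewrite ge0_integralZl//; congr (_ + _).
  under eq_integral do rewrite EFinD.
  rewrite ge0_integralD//; last 2 first.
  - by move=> z _; rewrite lee_fin mulr_ge0.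
  - by apply/measurable_EFinP; apply: measurable_funM => //; exact: mi1.
  rewrite (intI _ _ (mS1 _ mAC)).
  have [-> _] := cP1 _ mAC; rewrite muA mule0 adde0 integral_cst//.
  by rewrite [X in _ * X](_ : _ = 1) ?mule1//; exact: probability_setT.
have -> : \int[P2]_x F2 x = ((1 - t)^-1)%:E * transport_cost P2.
  rewrite /F2; under eq_integral do rewrite EFinD EFinM.
  rewrite ge0_integralD//; last 4 first.
  - by move=> z _; rewrite mule_ge0.
  - exact: emeasurable_funM.
  - by move=> z _; rewrite lee_fin ?mulr_ge0.
  - by apply/measurable_EFinP; apply: measurable_funM => //; exact: mi2.
  rewrite ge0_integralZl// (intI _ _ (mS2 _ mBC)).
  by have [_ ->] := cP2 _ mBC; rewrite muB mule0 adde0.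
move=> ineq.
have nuN : nu N \is a fin_num by exact: fin_num_measure.
have {ineq} : (1 - e)%:E * w%:E + kap%:E * (fine (nu N))%:E <=
    (t^-1)%:E * (t ^+ 2 * w + e)%:E + e%:E +
    ((1 - t)^-1)%:E * ((1 - t) ^+ 2 * w + e)%:E.
  rewrite fineK//; apply: le_trans (le_trans ineq _).
    by rewrite leeD2r// lee_wpmul2l ?lee_fin ?(ltW e1')//; exact: cost01.
  by rewrite leeD// ?leeD2r// lee_wpmul2l.
rewrite -!EFinM -!EFinD lee_fin !mulrDr.
have -> : (t^-1 * (t ^+ 2 * w) = t * w)%R by field; rewrite gt_eqF.
have -> : ((1 - t)^-1 * ((1 - t) ^+ 2 * w) = (1 - t) * w)%R by field; rewrite gt_eqF.
rewrite /K; lra.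
Qed.

End transport.

(** * Relative entropy: lower bound and uniform measures *)

Section entropy.
Context {R : realType} {d : measure_display} {X : borelCompleteMetricType R d}.
Variable m : {measure set X -> \bar R}.
Implicit Types (A S : set X) (mu : probability X R).

(* Jensen's inequality in tangent form: with [y = ln rho + ln (m S)], integrate
   [1 - y <= expR (- y)]. *)
Lemma expR_relative_entropy_le mu S (c : R) : measurable S -> mu (~` S) = 0 ->
  relative_entropy m mu <= c%:E -> (expR (- c))%:E <= m S.
Proof.
move=> mS muS.
have [->|mSfin] := eqVneq (m S) +oo; first by rewrite leey.
have mSE : m S \is a fin_num by rewrite ge0_fin_numE// ltey.
rewrite /relative_entropy; case: pselect => [ex|_]; last by rewrite leye_eq.
move: (sval _) (svalP (cid ex)) => rho [mrho rho0 muE] /=.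
case: ifPn => [_|fpos]; first by rewrite leye_eq.
pose f x : \bar R := (ln (rho x))%:E.
rewrite -[X in X <= c%:E -> _]/(\int[mu]_x f x) => fc.
have {}fpos : \int[mu]_x f^\+ x != +oo by [].
have mlnrho : measurable_fun setT (fun x => ln (rho x)).
  exact: (measurableT_comp (@measurable_ln R) mrho).
have mf : measurable_fun setT f by exact/measurable_EFinP.
have muS1 : mu S = 1.
  have := @probability_setC _ _ _ mu S mS; rewrite muS => /esym/eqP.
  by rewrite sube_eq ?fin_num_measure// ?add0e => /eqP <-.
pose M := fine (m S).
have M0 : (0 < M)%R.
  rewrite fine_gt0// lt0e measure_ge0 andbT ltey mSfin !andbT.
  apply/eqP => mS0; have := muE S mS; rewrite muS1 null_set_integral//.
    by move/eqP; rewrite onee_eq0.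
  exact/measurable_EFinP/measurable_funTS.
(* This is [expR (- y)] on [S]. Multiplied by the density it is at most [M^-1] there, so its
   [mu]-integral is at most [m S / M = 1]. *)
pose v x := (M^-1 * expR (- ln (rho x)) * \1_S x)%R.
have mv : measurable_fun setT v.
  apply: measurable_funM; last exact: measurable_indic.
  apply: measurable_funM => //.
  have mN : measurable_fun setT (fun x => - ln (rho x))%R by exact: measurableT_comp.
  exact: (measurableT_comp (@measurable_expR R) mN).
have v0 x : (0 <= v x)%R.
  by rewrite !mulr_ge0 ?invr_ge0 ?expR_ge0 ?(ltW M0).
have v1 : \int[mu]_x (v x)%:E <= 1.
  have mrhoE : measurable_fun setT (EFin \o rho) by exact/measurable_EFinP.
  rewrite (@integral_density _ _ _ m mu (EFin \o rho))//; last exact/measurable_EFinP.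
  have -> : 1%:E = \int[m]_x (M^-1 * \1_S x)%:E.
    under eq_integral do rewrite EFinM.
    rewrite ge0_integralZl//; last 2 first.
    - by apply/measurable_EFinP; exact: measurable_indic.
    - by rewrite lee_fin invr_ge0 ltW.
    rewrite integral_indic// setIT -(fineK mSE) -EFinM mulVf//.
    by rewrite gt_eqF.
  apply: ge0_le_integral => //.
  - by move=> x _; rewrite mule_ge0 ?lee_fin.
  - by apply: emeasurable_funM => //; exact/measurable_EFinP.
  - by apply/measurable_EFinP; exact: measurable_funM.
  move=> x _ /=; rewrite -EFinM lee_fin /v -!mulrA ler_pM2l ?invr_gt0//.
  rewrite mulrCA ler_piMr// expRN.
  have [->|rx0] := eqVneq (rho x) 0%R; first by rewrite mulr0.
  by rewrite lnK ?mulVf// posrE lt_def rx0 rho0.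
(* The negative part of the logarithm is not yet known to be integrable, so [ln M] is split too and
   [key] compares sums of nonnegative terms; integrability then follows from that of the positive
   part. *)
pose lp : R := Num.max (ln M) 0%R; pose lm : R := Num.max (- ln M)%R 0%R.
have lpm : (lp - lm = ln M)%R by rewrite /lp /lm /Num.max; case: ifPn; case: ifPn; lra.
have lp0 : (0 <= lp)%R by rewrite le_max lexx orbT.
have lm0 : (0 <= lm)%R by rewrite le_max lexx orbT.
have pnE x : exists p q : R, [/\ f^\+ x = p%:E, f^\- x = q%:E & (p - q = ln (rho x))%R].
  exists (Num.max (ln (rho x)) 0%R), (Num.max (- ln (rho x))%R 0%R).
  rewrite funeposE funenegE /f -EFinN !EFin_max; split => //.
  by rewrite /Num.max; case: ifPn; case: ifPn; lra.
have key : \int[mu]_x f^\- x + (1 + lm)%:E <= \int[mu]_x f^\+ x + (lp + 1)%:E.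
  have cst1 (r : R) : \int[mu]_x (cst r%:E x) = r%:E.
    rewrite integral_cst// [X in _ * X](_ : _ = 1) ?mule1//.
    exact: probability_setT.
  have mvE : measurable_fun setT (fun x => (v x)%:E) by exact/measurable_EFinP.
  have mp := measurable_funepos mf; have mn := measurable_funeneg mf.
  rewrite EFinD; apply: le_trans (_ : \int[mu]_x f^\+ x + (lp%:E + \int[mu]_x (v x)%:E) <= _); last first.
    by rewrite leeD2l// EFinD leeD2l.
  rewrite -EFinD -(cst1 (1 + lm)%R) -(cst1 lp) -!ge0_integralD//; last 4 first.
  - by move=> x _; rewrite adde_ge0 ?lee_fin.
  - exact: emeasurable_funD.
  - by move=> x _; rewrite lee_fin.
  - by move=> x _; rewrite lee_fin addr_ge0.
  apply: ae_ge0_le_integral => //.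
  - by move=> x _; rewrite adde_ge0// lee_fin addr_ge0.
  - exact: emeasurable_funD.
  - by move=> x _; rewrite !adde_ge0// lee_fin.
  - by do 2 apply: emeasurable_funD => //.
  exists (~` S); split => //; first exact: measurableC.
  move=> x /=; apply: contra_not => Sx _.
  have [p [q [-> -> pq]]] := pnE x; rewrite /= -!EFinD lee_fin.
  have -> : v x = expR (- (ln (rho x) + ln M)).
    rewrite /v indicE mem_set// mulr1 opprD expRD mulrC (expRN (ln M)) lnK//.
  have := expR_ge1Dx (- (ln (rho x) + ln M))%R; lra.
have p0 : 0 <= \int[mu]_x f^\+ x by apply: integral_ge0 => x _.
have q0 : 0 <= \int[mu]_x f^\- x by apply: integral_ge0 => x _.
have pfin : \int[mu]_x f^\+ x \is a fin_num by rewrite ge0_fin_numE// ltey.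
have qfin : \int[mu]_x f^\- x \is a fin_num.
  rewrite ge0_fin_numE//; move: key; rewrite -(fineK pfin) -EFinD.
  by case: (\int[mu]_x f^\- x) q0 => // r _ _; rewrite ltry.
move: fc key; rewrite integralE -(fineK pfin) -(fineK qfin).
rewrite -EFinB -!EFinD !lee_fin => fc key.
rewrite -(fineK mSE) lee_fin -/M -[leRHS](@lnK _ M)// ler_expR; lra.
Qed.

Lemma exists_uniform_probability A : measurable A -> 0 < m A < +oo ->
  exists mu : probability X R, forall S, measurable S ->
    mu S = m (S `&` A) * ((fine (m A))^-1)%:E.
Proof.
move=> mA /andP[A0 Aoo]; exists (mnormalize (mrestr m mA) point) => S mS.
rewrite -[LHS]/(mnormalize (mrestr m mA) point S) /mnormalize.
have -> : (mrestr m mA : {measure set X -> \bar R}) setT = m A.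
  exact: congr1 (setTI A).
by rewrite (gt_eqF A0) (lt_eqF Aoo).
Qed.

(** The density selected by choice agrees [m]-a.e. with the normalized indicator of [A]. The
    exceptional set and the complement of [A] are [mu]-null, so its logarithm is [mu]-a.e.
    constant. *)
Lemma relative_entropy_uniform A mu : measurable A -> 0 < m A < +oo ->
  (forall S, measurable S -> mu S = m (S `&` A) * ((fine (m A))^-1)%:E) ->
  relative_entropy m mu = (- ln (fine (m A)))%:E.
Proof.
move=> mA /andP[A0 Aoo] muE.
have mAfin : m A \is a fin_num by rewrite ge0_fin_numE.
pose M := fine (m A); have M0 : (0 < M)%R by rewrite fine_gt0// A0.
pose rho0 x := (M^-1 * \1_A x : R)%R.
have mind : measurable_fun setT (\1_A : X -> R) by exact: measurable_indic.
have mrho0 : measurable_fun setT rho0 by exact: measurable_funM.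
have intE S : measurable S -> \int[m]_(x in S) (rho0 x)%:E = mu S.
  move=> mS; under eq_integral do rewrite EFinM.
  rewrite ge0_integralZl//; last 2 first.
  - exact/measurable_EFinP/measurable_funTS.
  - by rewrite lee_fin invr_ge0 ltW.
  by rewrite integral_indic// muE// muleC setIC.
have dens0 : density m mu rho0.
  split => //; last by move=> S mS; rewrite intE.
  by move=> x; rewrite mulr_ge0// invr_ge0 ltW.
rewrite /relative_entropy; case: pselect => [ex|]; last by case; exists rho0.
move: (sval _) (svalP (cid ex)) => rho [mrho rho00 rhoE] /=.
have : ae_eq m setT (EFin \o rho0) (EFin \o rho).
  apply: integral_ae_eq => //.
  - apply/integrableP; split; first exact/measurable_EFinP.
    under eq_integral do rewrite gee0_abs ?lee_fin ?mulr_ge0 ?invr_ge0 ?(ltW M0)//.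
    by rewrite intE// -ge0_fin_numE// fin_num_measure.
  - exact/measurable_EFinP.
  - by move=> S _ mS; rewrite intE// rhoE.
move=> [N [mN N0 sN]].
pose f : X -> \bar R := fun x => (ln (rho x))%:E.
have mf : measurable_fun setT f.
  by apply/measurable_EFinP; exact: (measurableT_comp (@measurable_ln R) mrho).
have muN : mu (N `|` ~` A) = 0.
  apply/eqP; rewrite eq_le measure_ge0 andbT.
  have mAC := measurableC mA; apply: le_trans (measureU2 mu mN mAC) _.
  rewrite [X in X + _](muE _ mN) [X in _ + X](muE _ mAC).
  rewrite setICl measure0 mul0e adde0.
  rewrite (_ : m _ = 0) ?mul0e//; apply/eqP; rewrite eq_le measure_ge0 andbT -N0.
  by rewrite le_measure ?inE//; exact: measurableI.
have fE : ae_eq mu setT f (cst (- ln M)%:E).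
  exists (N `|` ~` A); split => //.
    by apply: measurableU => //; exact: measurableC.
  move=> x /=; rewrite -[X in X -> _]/(~ (setT x -> f x = _)).
  apply: contra_notP => /not_orP[Nx /contrapT Ax] _.
  have : rho0 x = rho x.
    apply: contrapT => h; apply: Nx; apply: sN => /= /(_ I)[].
    exact: h.
  rewrite /f /rho0 indicE mem_set// mulr1 => <-.
  by rewrite lnV.
have cst1 (r : R) : \int[mu]_x (cst r%:E x) = r%:E.
  rewrite integral_cst// [X in _ * X](_ : _ = 1) ?mule1//.
  exact: probability_setT.
have -> : (\int[mu]_x ((EFin \o (@ln R \o rho))^\+ x) == +oo) = false.
  have [fp _] := (iffLR (ae_eq_funeposneg mu setT f (cst (- ln M)%:E))) fE.
  rewrite (ae_eq_integral _ _ _ _ _ fp)//; [|exact: measurable_funepos|exact: measurable_funepos].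
  have -> : (cst (- ln M)%:E : X -> \bar R)^\+ = cst (Num.max (- ln M) 0)%:E.
    by apply/funext => x; rewrite funeposE /cst EFin_max.
  by rewrite cst1.
by rewrite -[LHS]/(\int[mu]_x f x) (ae_eq_integral _ _ _ _ _ fE).
Qed.

End entropy.

(** * Brunn-Minkowski inequality from convexity of the entropy *)

Section brunn_minkowski.
Context {R : realType} {d : measure_display} {X : borelCompleteMetricType R d}.
Implicit Types (A B : set X) (mu nu : probability X R).

Lemma integral_probability_le (d' : measure_display) (T : measurableType d')
    (Q : probability T R) (S : set T) (f : T -> R) (C : R) :
  measurable S -> Q (~` S) = 0 -> measurable_fun setT f ->
  (forall x, (0 <= f x)%R) -> (0 <= C)%R -> (forall x, S x -> (f x <= C)%R) ->
  \int[Q]_x (f x)%:E <= C%:E.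
Proof.
move=> mS QS mf f0 C0 fC.
have -> : C%:E = \int[Q]_x (cst C%:E x).
  rewrite integral_cst// [X in _ * X](_ : _ = 1) ?mule1//.
  exact: probability_setT.
apply: ae_ge0_le_integral => //.
- by move=> x _; rewrite lee_fin.
- exact/measurable_EFinP.
exists (~` S); split => //; first exact: measurableC.
by move=> x /=; apply: contra_not => Sx _; rewrite lee_fin fC.
Qed.

Definition transport_inf mu nu : \bar R :=
  ereal_inf [set transport_cost P | P in [set P | coupling mu nu P]].

Lemma W2E mu nu : W2 mu nu = sqrte (transport_inf mu nu).
Proof. by []. Qed.

Lemma transport_inf_ge0 mu nu : 0 <= transport_inf mu nu.
Proof.
apply: le_ereal_inf_tmp => _ [P _ <-]; apply: integral_ge0 => z _.
by rewrite lee_fin sqr_ge0.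
Qed.

(** The product coupling is carried by [A]*[B], so its cost is at most [L ^+ 2]. *)
Lemma transport_inf_lty mu nu A B (L : R) : @separable_space R d X ->
  measurable A -> measurable B -> mu (~` A) = 0 -> nu (~` B) = 0 ->
  (forall x y, A x -> B y -> (mdist x y <= L)%R) -> transport_inf mu nu < +oo.
Proof.
move=> sX mA mB muA nuB dAB.
have mAC := measurableC mA; have mBC := measurableC mB.
pose P : probability (X * X)%type R := mu \x nu.
have PE S S' : measurable S -> measurable S' -> P (S `*` S') = mu S * nu S'.
  by move=> mS mS'; rewrite -(product_measure1E mu nu mS mS').
have cP : coupling mu nu P.
  move=> S mS; split.
    rewrite (_ : fst @^-1` S = S `*` setT) ?PE// ?probability_setT ?mule1//.
    by apply/seteqP; split => [x|x []].
  rewrite (_ : snd @^-1` S = setT `*` S) ?PE// ?probability_setT ?mul1e//.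
  by apply/seteqP; split => [x|x []].
apply: le_lt_trans (ltry (L ^+ 2)); apply: ge_ereal_inf.
exists (transport_cost P); first by exists P.
apply: (@integral_probability_le _ _ P (A `*` B)) => //.
- exact: measurableX.
- have -> : ~` (A `*` B) = (fst @^-1` (~` A)) `|` (snd @^-1` (~` B)).
    apply/seteqP; split => x; last by case=> /= h [a b]; exact: h.
    rewrite -[X in X -> _]/(~ (A x.1 /\ B x.2)) => /not_andP.
    by case=> ?; [left|right].
  have mf : measurable (fst @^-1` (~` A) : set (X * X)).
    by rewrite -[X in measurable X]setTI; exact: measurable_fst.
  have ms : measurable (snd @^-1` (~` B) : set (X * X)).
    by rewrite -[X in measurable X]setTI; exact: measurable_snd.
  apply/eqP; rewrite eq_le measure_ge0 andbT.
  have PA : P (fst @^-1` (~` A)) <= 0 by have [-> _] := cP _ mAC; rewrite muA.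
  have PB : P (snd @^-1` (~` B)) <= 0 by have [_ ->] := cP _ mBC; rewrite nuB.
  apply: le_trans (measureU2 P mf ms) _; rewrite -[leRHS]adde0.
  exact: leeD PA PB.
- exact: measurable_funX (measurable_mdist2 sX).
- by move=> z; rewrite sqr_ge0.
- by rewrite sqr_ge0.
move=> [x y] [/= Ax By]; have dL := dAB _ _ Ax By.
by rewrite ler_sqr ?nnegrE ?mdist_ge0// (le_trans _ dL)// mdist_ge0.
Qed.

Lemma transport_inf_adherent mu nu (c e : R) : transport_inf mu nu = c%:E ->
  (0 < e)%R -> exists2 P, coupling mu nu P & transport_cost P <= (c + e)%:E.
Proof.
move=> cE e0; have : transport_inf mu nu < (c + e)%:E by rewrite cE lte_fin ltrDl.
by move=> /ereal_inf_lt[_ [P cP <-]] /ltW; exists P.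
Qed.

Lemma transport_infE mu nu (s : R) : (0 <= s)%R ->
  W2 mu nu = s%:E -> transport_inf mu nu = (s ^+ 2)%:E.
Proof.
move=> s0; rewrite W2E => sE.
by rewrite -[LHS]sqr_sqrte ?transport_inf_ge0// sE EFin_expe.
Qed.

Lemma brunn_minkowski (m : {measure set X -> \bar R}) A B (t L gam : R) :
  metric_measure_space m -> CD_0_infty m ->
  measurable A -> measurable B -> 0 < m A < +oo -> 0 < m B < +oo ->
  (0 < t < 1)%R -> (0 < gam)%R ->
  (forall x y, A x -> B y -> (mdist x y <= L)%R) ->
  (expR ((1 - t) * ln (fine (m A)) + t * ln (fine (m B))))%:E <=
  m (enlargement A (t * L + gam)).
Proof.
move=> mms cd mA mB mA0 mB0 t01 gam0 dAB; have /andP[t0 t1] := t01.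
have sX := mms_separable mms.
have [mu0 mu0E] := exists_uniform_probability mA mA0.
have [mu1 mu1E] := exists_uniform_probability mB mB0.
have mAC := measurableC mA; have mBC := measurableC mB.
have mu0A : mu0 (~` A) = 0 by rewrite mu0E// setICl measure0 mul0e.
have mu1B : mu1 (~` B) = 0 by rewrite mu1E// setICl measure0 mul0e.
have nonempty S : 0 < m S < +oo -> exists x, S x.
  move=> /andP[S0 _]; apply/set0P; apply/eqP => S00.
  by move: S0; rewrite S00 measure0 ltxx.
have [a Aa] := nonempty _ mA0; have [b Bb] := nonempty _ mB0.
have L0 : (0 <= L)%R by rewrite (le_trans _ (dAB _ _ Aa Bb))// mdist_ge0.
have ws mu S x : measurable S -> mu (~` S) = 0 ->
    (forall y, S y -> (mdist x y <= L)%R) -> wasserstein_space mu.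
  move=> mS muS dS; exists x; apply: le_lt_trans (ltry (L ^+ 2)).
  apply: (@integral_probability_le _ _ mu S) => //.
  - exact: measurable_funX (measurable_mdist _).
  - by move=> y; rewrite sqr_ge0.
  - by rewrite sqr_ge0.
  by move=> y Sy; rewrite ler_sqr ?nnegrE ?mdist_ge0//; exact: dS.
have ws0 : wasserstein_space mu0.
  by apply: (ws _ A b) => // y Ay; rewrite metric_sym dAB.
have ws1 : wasserstein_space mu1 by apply: (ws _ B a) => // y By; exact: dAB.
have [mu [muE0 muE1 _ geo] ent] := cd _ _ ws0 ws1.
have w_lty := transport_inf_lty sX mA mB mu0A mu1B dAB.
have w_ge0 := transport_inf_ge0 mu0 mu1.
pose w := fine (transport_inf mu0 mu1).
have wE : transport_inf mu0 mu1 = w%:E by rewrite fineK// ge0_fin_numE.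
have w0 : (0 <= w)%R by rewrite fine_ge0.
have W2w : W2 mu0 mu1 = (Num.sqrt w)%:E by rewrite W2E wE.
have t01' : (0 <= t <= 1)%R by rewrite !ltW.
(* Along a geodesic the distance is proportional to time, so the squared distance [w] is multiplied
   by [t ^+ 2] on the first leg and by [(1 - t) ^+ 2] on the second. *)
have inf0 : transport_inf (mu 0%R) (mu t) = (t ^+ 2 * w)%:E.
  rewrite -[X in (_ * X)%R](sqr_sqrtr w0) -exprMn; apply: transport_infE.
    by rewrite mulr_ge0 ?sqrtr_ge0// ltW.
  by rewrite geo ?lexx ?ler01// W2w sub0r normrN ger0_norm// ltW.
have inf1 : transport_inf (mu t) (mu 1%R) = ((1 - t) ^+ 2 * w)%:E.
  rewrite -[X in (_ * X)%R](sqr_sqrtr w0) -exprMn; apply: transport_infE.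
    by rewrite mulr_ge0 ?sqrtr_ge0// subr_ge0 ltW.
  by rewrite geo ?lexx ?ler01// W2w distrC ger0_norm// subr_ge0 ltW.
have muN : mu t (~` enlargement A (t * L + gam)) = 0.
  apply: (@intermediate_concentration _ _ _ mu0 _ mu1 t w L gam A B) => //.
  - by move=> P cP; rewrite -wE; apply: ereal_inf_lbound; exists P.
  - move=> e e0; have [P cP ?] := transport_inf_adherent inf0 e0; exists P => //.
    by move=> S mS; rewrite -muE0//; exact: cP.
  - move=> e e0; have [P cP ?] := transport_inf_adherent inf1 e0; exists P => //.
    by move=> S mS; rewrite -muE1//; exact: cP.
have := ent _ t01'.
rewrite (relative_entropy_uniform mA mA0 mu0E) (relative_entropy_uniform mB mB0 mu1E).
move=> entt.
(* The endpoint entropies are [- ln (fine (m A))] and [- ln (fine (m B))], so the exponent is minus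
   the convexity bound; on these finite values the dual addition is the usual one. *)
rewrite -[X in expR X]opprK.
apply: (expR_relative_entropy_le (measurable_enlargement _ _) muN).
apply: le_trans entt _.
rewrite -!EFinM -DualAddTheoryNumDomain.dEFinD lee_fin; lra.
Qed.

End brunn_minkowski.

(** * Linear growth of nondecreasing real functions *)

Section linear_growth.
Local Open Scope ring_scope.
Context {R : realType}.
Variable phi : R -> R.
Hypothesis phi_nd : forall r s, 1 <= r -> r <= s -> phi r <= phi s.

(** The rate is the infimum of the slopes [(phi s - phi 1) / (s - 2)], which gives the lower bound
    at once. An almost minimal [s], compared with all [r >= s] through the hypothesis, gives the
    upper bound. *)
Lemma linear_growth_rate :
  (forall s r, 2 < s -> s <= r ->
    (s - 2) * ((phi r - phi 1) / (r + 1)) <= phi s - phi 1) ->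
  exists h : R, [/\ 0 <= h, forall r, 2 < r -> phi 1 + h * (r - 2) <= phi r &
    forall e, 0 < e -> exists2 s, 2 < s &
      forall r, s <= r -> phi r <= phi 1 + (h + e) * (r + 1)].
Proof.
move=> star.
pose E : set R := [set (phi s - phi 1) / (s - 2) | s in [set s : R | 2 < s]].
have E0 : lbound E 0.
  move=> _ [s /= s2 <-]; rewrite divr_ge0// ?subr_ge0 ?(ltW s2)//.
  by apply: phi_nd => //; lra.
have hE : has_inf E.
  split; last by exists 0.
  by exists ((phi 3 - phi 1) / (3 - 2)); exists 3 => //=; lra.
exists (inf E); split.
- by apply: lb_le_inf => //; case: hE.
- move=> r r2; rewrite -lerBrDl -ler_pdivlMr ?subr_gt0//.
  by apply: ge_inf; [exists 0|exists r].
move=> e e0; have [_ [s /= s2 <-] se] := inf_adherent e0 hE.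
exists s => // r sr; rewrite -lerBlDl -ler_pdivrMr; last lra.
apply: le_trans (ltW se); rewrite ler_pdivlMr ?subr_gt0// mulrC.
exact: star.
Qed.

(** Continuous induction: the supremum of the points of [[1, r]] where the bound holds satisfies it
    too, and the local growth would push it further unless it is [r]. *)
Lemma local_to_global_growth (C : R) : 0 < C ->
  (forall r, 1 <= r -> exists2 dl, 0 < dl &
    forall e, 0 < e < dl -> phi r + C * e <= phi (r + e)) ->
  forall r, 1 <= r -> phi 1 + C * (r - 1) <= phi r.
Proof.
move=> C0 loc r r1.
pose S : set R := [set s | 1 <= s <= r /\ phi 1 + C * (s - 1) <= phi s].
have S1 : S 1 by split; [rewrite lexx|rewrite subrr mulr0 addr0].
have Sr : ubound S r by move=> s [/andP[]].
have hS : has_sup S by split; [exists 1|exists r].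
pose s := sup S.
have s1 : 1 <= s by apply: ub_le_sup => //; exists r.
have sr : s <= r by apply: ge_sup => //; exists 1.
(* [phi] may be discontinuous, but monotonicity gives [phi x <= phi s] for [x] in [S], so the bound
   on [x] passes to the supremum. *)
have Ss : phi 1 + C * (s - 1) <= phi s.
  rewrite leNgt; apply/negP => bad.
  have : s <= 1 + (phi s - phi 1) / C.
    apply: ge_sup; first by exists 1.
    move=> x [/andP[x1 xr] xP]; rewrite -lerBlDl ler_pdivlMr// mulrC lerBrDl.
    apply: (le_trans xP); apply: phi_nd => //.
    by apply: ub_le_sup; [exists r|split; [rewrite x1|]].
  by rewrite -lerBlDl ler_pdivlMr// mulrC lerBrDl leNgt bad.
have [->//|] := eqVneq r s; rewrite eq_sym => rs.
have sr' : s < r by rewrite lt_neqAle rs sr.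
have [dl dl0 dlP] := loc s s1.
pose e := Num.min (dl / 2) (r - s).
have e0 : 0 < e by rewrite lt_min divr_gt0//= subr_gt0.
have edl : e < dl by rewrite gt_min; apply/orP; left; lra.
have er : e <= r - s by rewrite ge_min lexx orbT.
have Se : S (s + e).
  split; first by apply/andP; split; lra.
  by have := dlP e; rewrite e0 edl => /(_ isT); lra.
have : s + e <= s by apply: ub_le_sup => //; exists r.
lra.
Qed.

End linear_growth.

(** * Finiteness and exponential growth of the volume of balls *)

Section volume_growth.
Context {R : realType} {d : measure_display} {X : borelCompleteMetricType R d}.
Variables (m : {measure set X -> \bar R}) (x0 : X).
Hypotheses (mms : metric_measure_space m) (cd : CD_0_infty m).
Implicit Types (A K : set X).

Lemma compact_measurable K : compact K -> measurable K.
Proof.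
move=> /(compact_closed (@metric_hausdorff R X)) cK.
by rewrite -[K]setCK; apply/measurableC/borel_open_measurable/closed_openC.
Qed.

Lemma compact_measure_lty K : compact K -> m K < +oo.
Proof.
move=> cK; have mK := compact_measurable cK.
have /choice[U UP] : forall x, exists U : set X, [/\ open U, U x & m U < +oo].
  by move=> x; have [U [oU Ux] mU] := mms_locally_finite mms x; exists U.
move: cK; rewrite compact_cover => /(_ _ setT U).
case => [x _|x _|D _ KD]; [by have [] := UP x|by exists x => //; have [] := UP x|].
have mU x : measurable (U x) by apply: borel_open_measurable; have [] := UP x.
have KU : m K <= m (\big[setU/set0]_(i <- finmap.enum_fset D) U i).
  apply: le_measure; rewrite ?inE//; first exact: bigsetU_measurable.
  by apply: (subset_trans KD); rewrite coverE bigcup_fset.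
apply: le_lt_trans KU _.
elim: (finmap.enum_fset D) => [|x s IH]; first by rewrite big_nil measure0 ltry.
rewrite big_cons; apply: le_lt_trans (measureU2 _ _ _) _ => //.
  exact: bigsetU_measurable.
by rewrite lte_add_pinfty//; have [] := UP x.
Qed.

Lemma measure_ball_gt0 (r : R) : (0 < r)%R -> 0 < m (ball x0 r).
Proof.
move=> r0; apply: (mms_full_support mms); first exact: metric_ball_open.
by exists x0; rewrite ballEmdist/= mdistxx.
Qed.

Lemma le_measure_ball (r s : R) : (r <= s)%R -> m (ball x0 r) <= m (ball x0 s).
Proof.
move=> rs; apply: le_measure; rewrite ?inE; [exact: measurable_metric_ball..|].
exact: le_ball.
Qed.

(** Brunn-Minkowski between a small ball and a compact [K] inside [ball x0 r] bounds [m K]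
    uniformly, since for small [t] the enlargement stays in a neighborhood of finite measure. Inner
    regularity extends the bound to the ball. *)
Lemma measure_ball_lty (r : R) : (0 < r)%R -> m (ball x0 r) < +oo.
Proof.
move=> r0; have [U [oU Ux] mU] := mms_locally_finite mms x0.
have /nbhs_ballP[rho /= rho0 rhoU] : nbhs x0 U by exact: open_nbhs_nbhs.
have mrho : m (ball x0 rho) < +oo.
  apply: le_lt_trans mU; apply: le_measure; rewrite ?inE//.
    exact: measurable_metric_ball.
  exact: borel_open_measurable.
(* One third each for the radius of the small ball, for [t * L] and for the margin [gam = e]. *)
pose e := (rho / 3)%R; have e0 : (0 < e)%R by rewrite divr_gt0.
have rhoE : (rho = 3 * e)%R by rewrite /e; lra.
have A0 : 0 < m (ball x0 e) < +oo.
  rewrite measure_ball_gt0//=; apply: le_lt_trans mrho; apply: le_measure_ball.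
  by lra.
pose L := (e + r)%R; pose t := (e / (e + L))%R.
have L0 : (0 < L)%R by rewrite addr_gt0.
have eL0 : (0 < e + L)%R by rewrite addr_gt0.
have t01 : (0 < t < 1)%R.
  by rewrite /t divr_gt0//= ltr_pdivrMr// mul1r ltrDl.
have tL : (t * L <= e)%R.
  by rewrite /t mulrAC ler_pdivrMr// ler_wpM2l// ?(ltW e0)// lerDr ltW.
pose c := fine (m (ball x0 rho)).
have cE : m (ball x0 rho) = c%:E by rewrite fineK// ge0_fin_numE.
have c0 : (0 < c)%R by rewrite -lte_fin -cE measure_ball_gt0.
(* This solves [(1 - t) * ln (fine (m (ball x0 e))) + t * b = ln c], so [b] bounds
   [ln (fine (m K))]. *)
pose b := ((ln c - (1 - t) * ln (fine (m (ball x0 e)))) / t)%R.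
apply: (@le_lt_trans _ _ (expR b)%:E); last exact: ltry.
rewrite (mms_inner_regular mms); last exact: measurable_metric_ball.
apply: ge_ereal_sup => _ [K [cK Kr] <-].
have [->|K0] := eqVneq (m K) 0; first by rewrite lee_fin expR_ge0.
have Kfin := compact_measure_lty cK.
have mK0 : 0 < m K < +oo by rewrite lt0e K0 measure_ge0.
have dL x y : ball x0 e x -> K y -> (mdist x y <= L)%R.
  move=> + /Kr; rewrite !ballEmdist/= => xe yr.
  have := metric_triangle x x0 y; rewrite (metric_sym x x0) /L; lra.
have := brunn_minkowski mms cd (measurable_metric_ball x0 e)
  (compact_measurable cK) A0 mK0 t01 e0 dL.
have sub : m (enlargement (ball x0 e) (t * L + e)) <= m (ball x0 rho).
  apply: le_measure; rewrite ?inE; [exact: measurable_enlargement|exact: measurable_metric_ball|].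
  apply: (subset_trans (@enlargement_ball _ _ _ _ _ _)); apply: le_ball; lra.
move=> /le_trans/(_ sub); rewrite cE lee_fin => bm.
have KE : m K = (fine (m K))%:E by rewrite fineK// ge0_fin_numE.
have k0 : (0 < fine (m K))%R by rewrite fine_gt0.
rewrite KE lee_fin -[leLHS](@lnK _ (fine (m K)))// ler_expR /b.
have /andP[t0 _] := t01.
rewrite ler_pdivlMr// lerBrDl.
move: bm; rewrite -[X in (_ <= X)%R](@lnK _ c)// ler_expR; lra.
Qed.

Definition log_volume (r : R) : R := ln (fine (m (ball x0 r))).

Lemma measure_ballE (r : R) : (0 < r)%R ->
  m (ball x0 r) = (expR (log_volume r))%:E.
Proof.
move=> r0; have lty := measure_ball_lty r0; have gt0 := measure_ball_gt0 r0.
by rewrite /log_volume lnK ?posrE ?fine_gt0 ?gt0 ?fineK// ge0_fin_numE.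
Qed.

Lemma le_log_volume (r s : R) : (0 < r)%R -> (r <= s)%R ->
  (log_volume r <= log_volume s)%R.
Proof.
move=> r0 rs; rewrite -ler_expR -lee_fin -!measure_ballE//.
  exact: le_measure_ball.
exact: lt_le_trans rs.
Qed.

(** Brunn-Minkowski between [ball x0 1] and [ball x0 r] with [L = r + 1] and [t * L = s - 2]: the
    missing 2 is the unit radius plus the margin [gam = 1], so the enlargement lies in
    [ball x0 s]. *)
Lemma log_volume_star (s r : R) : (2 < s)%R -> (s <= r)%R ->
  ((s - 2) * ((log_volume r - log_volume 1) / (r + 1)) <=
   log_volume s - log_volume 1)%R.
Proof.
move=> s2 sr; have r0 : (0 < r)%R by lra.
have r1 : (0 < r + 1)%R by lra.
pose t := ((s - 2) / (r + 1))%R.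
have t01 : (0 < t < 1)%R.
  by rewrite /t divr_gt0 ?subr_gt0//= ltr_pdivrMr//; lra.
have b0 (u : R) : (0 < u)%R -> 0 < m (ball x0 u) < +oo.
  by move=> u0; rewrite measure_ball_gt0// measure_ball_lty.
have dL x y : ball x0 1%R x -> ball x0 r y -> (mdist x y <= r + 1)%R.
  rewrite !ballEmdist/= => xe yr.
  have := metric_triangle x x0 y; rewrite (metric_sym x x0); lra.
have := brunn_minkowski mms cd (measurable_metric_ball x0 1)
  (measurable_metric_ball x0 r) (b0 _ ltr01) (b0 _ r0) t01 ltr01 dL.
have tr : (t * (r + 1) = s - 2)%R by rewrite /t divfK// gt_eqF.
have sub : m (enlargement (ball x0 1%R) (t * (r + 1) + 1)) <= m (ball x0 s).
  apply: le_measure; rewrite ?inE; [exact: measurable_enlargement|exact: measurable_metric_ball|].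
  apply: (subset_trans (@enlargement_ball _ _ _ _ _ _)); apply: le_ball; lra.
move=> /le_trans/(_ sub); rewrite (@measure_ballE s); last lra.
rewrite lee_fin ler_expR -/(log_volume 1) -/(log_volume r).
have -> : ((s - 2) * ((log_volume r - log_volume 1) / (r + 1)) =
    t * (log_volume r - log_volume 1))%R by rewrite /t; ring.
by move: (log_volume 1) (log_volume r) (log_volume s) => a b c bm; lra.
Qed.

Lemma volume_entropy_growth : exists h : R, [/\ (0 <= h)%R,
  volume_entropy m x0 = h%:E,
  forall r, (2 < r)%R -> (log_volume 1 + h * (r - 2) <= log_volume r)%R &
  forall e, (0 < e)%R -> exists2 s, (2 < s)%R &
    forall r, (s <= r)%R -> (log_volume r <= log_volume 1 + (h + e) * (r + 1))%R].
Proof.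
have [|h [h0 lo hi]] := linear_growth_rate _ log_volume_star.
  by move=> r s r1 rs; apply: le_log_volume => //; lra.
exists h; split => //; apply/cvg_lim => //.
have : (EFin \o (fun r => log_volume r / r)%R) r @[r --> +oo%R] --> h%:E.
  apply: cvg_EFin; first exact: nearW.
  apply/cvgrPdist_le => e e0.
  have e20 : (0 < e / 2)%R by rewrite divr_gt0.
  have [s s2 sP] := hi _ e20.
  (* [K] dominates the constant terms of both linear bounds; for [r >= 2 * K / e] they are at most
     [e / 2 * r]. *)
  pose K := (`|log_volume 1| + 2 * h + e)%R.
  near=> r.
  have r2 : (2 < r)%R by near: r; apply: nbhs_pinfty_gt; exact: num_real.
  have r0 : (0 < r)%R by lra.
  have rs : (s <= r)%R by near: r; apply: nbhs_pinfty_ge; exact: num_real.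
  have rK : (2 * K / e <= r)%R by near: r; apply: nbhs_pinfty_ge; exact: num_real.
  move: rK; rewrite ler_pdivrMr// => rK.
  have n1 := ler_norm (log_volume 1); have n2 := ler_norm (- log_volume 1)%R.
  rewrite normrN in n2.
  rewrite ler_distlC; apply/andP; split.
    rewrite ler_pdivlMr//; have := lo r r2; rewrite /K in rK; nra.
  rewrite ler_pdivrMr//; have := sP r rs; rewrite /K in rK; nra.
apply: cvg_trans; apply: near_eq_cvg; near=> r.
have r0 : (0 < r)%R by near: r; apply: nbhs_pinfty_gt; exact: num_real.
rewrite /= measure_ballE// lne_EFin ?expR_gt0// expRK inver gt_eqF//.
Unshelve. all: by end_near.
Qed.

End volume_growth.

(** * Isoperimetric inequality and its sharpness *)

Lemma ediv_EFin (R : realType) (x : \bar R) (r : R) :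
  (0 < r)%R -> x / r%:E = x * (r^-1)%:E.
Proof. by move=> r0; rewrite inver gt_eqF. Qed.

Section cheeger.
Context {R : realType} {d : measure_display} {X : borelCompleteMetricType R d}.
Variables (m : {measure set X -> \bar R}) (x0 : X).
Hypotheses (mms : metric_measure_space m) (cd : CD_0_infty m).
Implicit Types (A Omega : set X).

Let phi := log_volume m x0.

Section lower_bound.
Variable h : R.
Hypothesis h0 : (0 <= h)%R.
Hypothesis h_lo : forall r, (2 < r)%R -> (phi 1 + h * (r - 2) <= phi r)%R.

(* Brunn-Minkowski against [ball x0 r] with [r] going to infinity. *)
Lemma enlargement_bounded_growth Omega (D e : R) : measurable Omega ->
  0 < m Omega < +oo -> (0 < D)%R -> Omega `<=` ball x0 D -> (0 < e)%R ->
  (expR (ln (fine (m Omega)) + h * e))%:E <= m (enlargement Omega e).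
Proof.
move=> mO mO0 D0 OD e0.
have [->|fin] := eqVneq (m (enlargement Omega e)) +oo; first by rewrite leey.
have EE : m (enlargement Omega e) = (fine (m (enlargement Omega e)))%:E.
  by rewrite fineK// ge0_fin_numE// ltey.
set a := ln (fine (m Omega)).
pose v := ln (fine (m (enlargement Omega e))).
have E0 : (0 < fine (m (enlargement Omega e)))%R.
  rewrite -lte_fin -EE; have /andP[Om0 _] := mO0; apply: lt_le_trans Om0 _.
  apply: le_measure; rewrite ?inE//; first exact: measurable_enlargement.
  exact: subset_enlargement.
suff : (a + h * e <= v)%R.
  by move=> av; rewrite EE lee_fin -[leRHS](@lnK _ (fine _)) ?posrE// ler_expR.
apply/ler_addgt0Pr => del del0.
(* The error [del] is shared equally between [h * gm], caused by the margin in Brunn-Minkowski, and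
   [t * K], caused by the constants independent of [r]. *)
pose gm := Num.min (e / 2)%R (del / (2 * (h + 1)))%R.
have h1 : (0 < 2 * (h + 1) :> R)%R by rewrite mulr_gt0// ltr_wpDl.
have gm0 : (0 < gm)%R by rewrite lt_min !divr_gt0.
have gme : (gm <= e / 2)%R by rewrite ge_min lexx.
have hgm : (h * gm <= del / 2)%R.
  have : (gm <= del / (2 * (h + 1)))%R by rewrite ge_min lexx orbT.
  rewrite ler_pdivlMr//; nra.
pose K := (`|h * (D + 2) - phi 1 + a| + 1)%R.
have K0 : (0 < K)%R by rewrite ltr_wpDl.
have KN : (h * (D + 2) - phi 1 + a <= K)%R.
  by rewrite (le_trans (ler_norm _))// lerDl.
(* The last term makes [t * K <= del / 2], as [t <= e / L]; the first two ensure [r > 2] and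
   [t < 1]. *)
pose r := (3 + e + 2 * e * K / del)%R.
have q0 : (0 < 2 * e * K / del)%R by rewrite divr_gt0// !mulr_gt0.
have r3 : (2 < r)%R by rewrite /r; lra.
have r0 : (0 < r)%R by lra.
pose L := (r + D)%R; have L0 : (0 < L)%R by rewrite /L; lra.
pose t := ((e - gm) / L)%R.
have t01 : (0 < t < 1)%R.
  rewrite /t divr_gt0 ?subr_gt0//=; last by lra.
  by rewrite ltr_pdivrMr// mul1r /L /r; lra.
have /andP[t0 t1] := t01.
have tL : (t * L = e - gm)%R by rewrite /t divfK// gt_eqF.
have tK : (t * K <= del / 2)%R.
  rewrite /t mulrAC ler_pdivrMr//.
  have LL : (2 * e * K / del <= L)%R by rewrite /L /r; lra.
  move: LL; rewrite ler_pdivrMr// => LL; nra.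
have b0 : 0 < m (ball x0 r) < +oo.
  by rewrite (measure_ball_gt0 x0 mms r0) (measure_ball_lty x0 mms cd r0).
have dL x y : Omega x -> ball x0 r y -> (mdist x y <= L)%R.
  move=> /OD; rewrite !ballEmdist/= => xD yr.
  have := metric_triangle x x0 y; rewrite (metric_sym x x0) /L; lra.
have := brunn_minkowski mms cd mO (measurable_metric_ball x0 r) mO0 b0 t01 gm0 dL.
rewrite tL subrK EE lee_fin -[X in (_ <= X)%R](@lnK _ (fine _)) ?posrE//.
rewrite ler_expR -/v -/a -/(log_volume m x0 r) -/phi => bm.
have lo := h_lo r3.
have tlo : (t * (phi 1 + h * (r - 2)) <= t * phi r)%R by rewrite ler_pM2l.
have tKN : (t * (h * (D + 2) - phi 1 + a) <= t * K)%R by rewrite ler_pM2l.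
have thL : (h * (t * L) = h * (e - gm))%R by rewrite tL.
rewrite /L in thL; nra.
Qed.

(** Intersecting with growing balls reduces to the bounded case, and continuity from below gives the
    limit. The linearization [1 + h * e <= expR (h * e)] avoids logarithms, so null pieces need no
    positivity. *)
Lemma enlargement_growth Omega (e : R) : measurable Omega ->
  (0 < e)%R -> m Omega * (1 + h * e)%:E <= m (enlargement Omega e).
Proof.
move=> mO e0.
pose F n := Omega `&` ball x0 n.+1%:R.
have mF n : measurable (F n) by apply: measurableI => //; exact: measurable_metric_ball.
have UF : \bigcup_n F n = Omega.
  apply/seteqP; split => [x [n _ []]//|x Ox].
  exists (Num.truncn (mdist x0 x)) => //; split => //.
  by rewrite ballEmdist/=; exact: truncnS_gt.
have ndF : nondecreasing_seq F.
  move=> n k nk; apply/subsetPset; apply: setIS; apply: le_ball.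
  by rewrite ler_nat ltnS.
have cF : m (F n) @[n --> \oo] --> m Omega.
  rewrite -[in X in _ --> X]UF; apply: nondecreasing_cvg_mu => //.
  by rewrite UF.
have he0 : (0 <= h * e)%R by rewrite mulr_ge0// ltW.
have cFh : m (F n) * (1 + h * e)%:E @[n --> \oo] --> m Omega * (1 + h * e)%:E.
  exact: cvgeZr.
rewrite -(cvg_lim _ cFh)//; apply: lime_le; first by apply/cvg_ex; eexists; exact: cFh.
apply: nearW => n.
have FO : m (enlargement (F n) e) <= m (enlargement Omega e).
  apply: le_measure; rewrite ?inE; [exact: measurable_enlargement..|].
  by apply: enlargementS => x [].
apply: le_trans FO.
have [->|F0] := eqVneq (m (F n)) 0; first by rewrite mul0e.
have n0 : (0 < n.+1%:R :> R)%R by rewrite ltr0n.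
have Flty : m (F n) < +oo.
  apply: le_lt_trans (measure_ball_lty x0 mms cd n0); apply: le_measure; rewrite ?inE//.
    exact: measurable_metric_ball.
  by move=> x [].
have FP : 0 < m (F n) < +oo by rewrite lt0e F0 measure_ge0.
apply: le_trans (enlargement_bounded_growth (mF n) FP n0 _ e0); last by move=> x [].
have FE : m (F n) = (fine (m (F n)))%:E by rewrite fineK// ge0_fin_numE.
rewrite {1}FE -EFinM lee_fin expRD lnK ?posrE ?fine_gt0//.
by rewrite ler_wpM2l ?fine_ge0// expR_ge1Dx.
Qed.

Lemma minkowski_content_ge Omega : measurable Omega -> m Omega < +oo ->
  h%:E * m Omega <= minkowski_content m Omega.
Proof.
move=> mO Olty; rewrite /minkowski_content limf_einfE; apply: le_ereal_sup_tmp.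
(* The bound holds for every difference quotient with [e > 0], so all positive numbers serve as the
   neighborhood. *)
exists (ereal_inf [set (m (enlargement Omega e) - m Omega) / e%:E |
    e in [set e : R | (0 < e)%R]]).
  by exists [set e : R | (0 < e)%R] => //=; exact: nbhs_right_gt.
apply: le_ereal_inf_tmp => _ [e /= e0 <-].
have OE : m Omega = (fine (m Omega))%:E by rewrite fineK// ge0_fin_numE.
have := enlargement_growth mO e0; rewrite OE ediv_EFin// lee_pdivlMr// leeBrDr//.
by apply: le_trans; rewrite -!EFinM -EFinD lee_fin; lra.
Qed.

End lower_bound.

Lemma minkowski_content_gt Omega (c : R) : c%:E < minkowski_content m Omega ->
  exists2 dl : R, (0 < dl)%R & forall e : R, (0 < e < dl)%R ->
    c%:E < (m (enlargement Omega e) - m Omega) / e%:E.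
Proof.
rewrite /minkowski_content limf_einfE => /ereal_sup_gt[_ [V V0 <-] cV].
have /nbhs_ballP[dl /= dl0 dlV] : nbhs (0%R : R) [set u : R | (0 < u)%R -> V u].
  exact: V0.
exists dl => // e /andP[e0 edl]; apply: lt_le_trans cV _.
apply: ereal_inf_lbound; exists e => //; apply: dlV => //=.
by rewrite /ball/= sub0r normrN gtr0_norm.
Qed.

(** Enlarging [ball x0 r] by [e] stays in [ball x0 (r + e)], so the volume grows by a factor at
    least [1 + c * e], which dominates [expR (c' * e)] for small [e] because [c' < c]. *)
Lemma ball_growth_of_minkowski (c c' r : R) : (0 < c' < c)%R -> (0 < r)%R ->
  (c * fine (m (ball x0 r)))%:E < minkowski_content m (ball x0 r) ->
  exists2 dl : R, (0 < dl)%R & forall e : R, (0 < e < dl)%R ->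
    (phi r + c' * e <= phi (r + e))%R.
Proof.
move=> /andP[c'0 cc'] r0 /minkowski_content_gt[dl dl0 dlP].
have c0 : (0 < c)%R by lra.
exists (Num.min dl ((c - c') / (c * c')))%R.
  by rewrite lt_min dl0 divr_gt0 ?subr_gt0 ?mulr_gt0.
move=> e /andP[e0]; rewrite lt_min ltr_pdivlMr ?mulr_gt0// => /andP[edl ecc].
have := dlP e; rewrite e0 edl => /(_ isT) /ltW.
have re0 : (0 < r + e)%R by rewrite addr_gt0.
rewrite (measure_ballE x0 mms cd r0) ediv_EFin// lee_pdivlMr// leeBrDr//= -/phi.
have sub : m (enlargement (ball x0 r) e) <= m (ball x0 (r + e)).
  apply: le_measure; rewrite ?inE; [exact: measurable_enlargement|exact: measurable_metric_ball|].
  exact: enlargement_ball.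
move=> /le_trans/(_ sub); rewrite (measure_ballE x0 mms cd re0) -/phi.
rewrite -EFinM -EFinD lee_fin => growth.
rewrite -ler_expR expRD; apply: le_trans growth.
have -> : (c * expR (phi r) * e + expR (phi r) = expR (phi r) * (1 + c * e))%R by ring.
rewrite ler_pM2l ?expR_gt0//.
(* [expR x <= 1 / (1 - x)] with [x = c' * e], and [e <= (c - c') / (c * c')]. *)
have ce1 : (0 < 1 - c' * e)%R by nra.
have := expR_ge1Dx (- (c' * e))%R; rewrite expRN => inv.
have E0 : (0 < expR (c' * e))%R by exact: expR_gt0.
have : (expR (c' * e) * (1 - c' * e) <= 1)%R.
  rewrite -[leRHS](@mulfV _ (expR (c' * e))) ?gt_eqF// ler_pM2l//.
move=> EE; nra.
Qed.

End cheeger.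

Theorem theorem1p5 (R : realType) (d : measure_display)
    (X : borelCompleteMetricType R d) (m : {measure set X -> \bar R})
    (x0 : X) (mms : metric_measure_space m) (cd : CD_0_infty m) :
  let h := volume_entropy m x0 in
  [/\ forall Omega : set X, measurable Omega -> m Omega < +oo ->
        h * m Omega <= minkowski_content m Omega,
      h <= cheeger_constant m &
      forall C : R, h < C%:E ->
        exists Omega : set X, [/\ measurable Omega, 0 < m Omega < +oo &
          ~ (C%:E * m Omega <= minkowski_content m Omega)]].
Proof.
have [h [h0 -> lo hi]] := volume_entropy_growth x0 mms cd; pose phi := log_volume m x0.
split.
- by move=> Omega; exact: (minkowski_content_ge mms cd h0 lo).
- apply: le_ereal_inf_tmp => _ [A [mA /andP[A0 Alty]] <-].
  have AE : m A = (fine (m A))%:E by rewrite fineK// ge0_fin_numE.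
  have M0 : (0 < fine (m A))%R by rewrite -lte_fin -AE.
  rewrite [X in _ / X]AE ediv_EFin// lee_pdivlMr// -AE.
  exact: (minkowski_content_ge mms cd h0 lo).
move=> C; rewrite lte_fin => hC; apply: contrapT => nex.
have cheeg r : (0 < r)%R ->
    C%:E * m (ball x0 r) <= minkowski_content m (ball x0 r).
  move=> r0; apply: contrapT => nle; apply: nex; exists (ball x0 r).
  split => //; first exact: measurable_metric_ball.
  by rewrite (measure_ball_gt0 x0 mms r0) (measure_ball_lty x0 mms cd r0).
(* Intermediate rates [h < c' < c < C]: [c < C] makes the content bound strict, and [c' < c] pays
   for the passage to logarithms. *)
pose c := ((h + 3 * C) / 4)%R; pose c' := ((h + C) / 2)%R.
have cc' : (0 < c' < c)%R by rewrite /c /c'; lra.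
have /andP[c'0 _] := cc'.
have glob : forall r, (1 <= r)%R -> (phi 1 + c' * (r - 1) <= phi r)%R.
  apply: local_to_global_growth => //.
    by move=> r s r1 rs; apply: le_log_volume => //; lra.
  move=> r r1; have r0 : (0 < r)%R by lra.
  apply: (ball_growth_of_minkowski mms cd cc') => //.
  apply: lt_le_trans (cheeg r r0); rewrite (measure_ballE x0 mms cd r0) -EFinM lte_fin/=.
  by rewrite ltr_pM2r ?expR_gt0// /c; lra.
pose e := ((C - h) / 4)%R; have e0 : (0 < e)%R by rewrite /e; lra.
have [s s2 sP] := hi e e0.
(* Since [c' - (h + e) = e], the two linear bounds on [phi r] force [e * r <= c' + h + e], which
   this [r] violates. *)
pose r := Num.max s ((c' + h + e) / e + 1)%R.
have sr : (s <= r)%R by rewrite le_max lexx.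
have rK : ((c' + h + e) / e + 1 <= r)%R by rewrite le_max lexx orbT.
have r1 : (1 <= r)%R by lra.
have g1 := glob r r1; have g2 := sP r sr.
have : ((c' + h + e) / e < r)%R by lra.
rewrite ltr_pdivrMr//; rewrite -/phi in g2; rewrite /c' /e in g1 g2 *; nra.
Qed.
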